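(* Let $\Gamma$ be a finitely generated nilpotent group. Then there exists $k\in\mathbb{N}$ such that $\mathrm{Conj}_\Gamma(n)\preceq n^k$.
   Context: For non-decreasing non-negative functions $f,g$ on $\mathbb{N}=\{1,2,\dots\}$, write $f\preceq g$ if there is $C\in\mathbb{N}$ with $f(n)\le C\,g(Cn)$ for all $n$, and $f\approx g$ if $f\preceq g$ and $g\preceq f$. For a finitely generated group $\Gamma$ with finite generating subset $S$ and word length $\|\cdot\|_S$, write $\gamma\sim\eta$ if $\gamma,\eta$ are conjugate. For $\gamma\nsim\eta$ put $\mathrm{CD}_\Gamma(\gamma,\eta)=\min\{|Q| : \varphi:\Gamma\to Q \text{ a surjective homomorphism to a finite group},\ \varphi(\gamma)\nsim\varphi(\eta)\}$ ($=\infty$ if there is no such $\varphi$), and $\mathrm{Conj}_{\Gamma,S}(n)=\max\{\mathrm{CD}_\Gamma(\gamma,\eta) : \gamma\nsim\eta,\ \|\gamma\|_S,\|\eta\|_S\le n\}$. Up to $\approx$ this is independent of $S$, and one writes $\mathrm{Conj}_\Gamma$. *)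

(* Defs.v *)
From mathcomp Require Import all_boot all_order all_algebra all_fingroup.
From mathcomp Require Import boolp classical_sets reals constructive_ereal ereal.

Set Implicit Arguments.
Unset Strict Implicit.
Unset Printing Implicit Defensive.

Import Order.TTheory GRing.Theory Num.Theory.

Local Open Scope classical_set_scope.
Local Open Scope ring_scope.

(* Infinite groups are the [groupType] of [boot/monoid.v]; finite quotients are
   [finGroupType]s, which are in particular [groupType]s. *)
Section Groups.
Variable G : groupType.
Implicit Types (x y : G) (A H : set G).

Definition subgroup H : Prop := group_closed [in H].

Definition generated_subgroup A : set G := smallest subgroup A.

(* Indexed from 0: [lcs 0] is the whole group, and [lcs c.+1] is generated by
   the commutators of [lcs c] with the whole group. *)
Fixpoint lcs (c : nat) : set G :=
  if c is c'.+1 then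
    generated_subgroup [set [~ x, y]%g | x in lcs c' & y in setT]
  else setT.

Definition nilpotent_group : Prop := exists c, lcs c = [set 1%g].

Definition generating (S : seq G) : Prop := generated_subgroup [set` S] = setT.

Definition finitely_generated : Prop := exists S : seq G, generating S.

Definition conjugated x y : Prop := exists z, y = (x ^ z)%g.

End Groups.

(* The extended reals serve as a common home for the values, which lie in
   N u {oo}. *)
Section ConjugacySeparability.
Variables (R : realType) (G : groupType).
Implicit Types (x y : G) (S : seq G).

(* A word over S is a sequence of letters each of which, or its inverse, is in
   S. The infimum is over a set of naturals, hence a minimum, and it is +oo
   exactly when x is outside the subgroup generated by S. *)
Definition word_length S x : \bar R :=
  ereal_inf [set (size w)%:R%:E | w in
    [set w : seq G | {in w, forall s, (s \in S) || (s^-1%g \in S)}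
                     /\ (\prod_(s <- w) s)%g = x]].

(* The orders of the finite quotients of G in which the images of x and y are
   not conjugate. *)
Definition separating_orders x y : set nat :=
  [set m | exists (Q : finGroupType) (phi : {multiplicative G -> Q}),
     [/\ range phi = setT, ~ conjugated (phi x) (phi y) & #|Q| = m]].

(* [ereal_inf] is a minimum over a nonempty set of naturals, +oo over the empty
   set. *)
Definition CD x y : \bar R :=
  ereal_inf [set m%:R%:E | m in separating_orders x y].

(* The balls of G are finite, so the supremum is a maximum. [supremum 0] gives
   the value 0 when there is no pair to consider, e.g. for the trivial group. *)
Definition Conj S (n : nat) : \bar R :=
  supremum 0%E [set CD p.1 p.2 | p in
    [set p : G * G | [/\ ~ conjugated p.1 p.2,
                         (word_length S p.1 <= n%:R%:E)%E
                       & (word_length S p.2 <= n%:R%:E)%E]]].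

End ConjugacySeparability.

(* Functions on N = {1, 2, ...}: the value at 0 is ignored. *)
Definition growth_le (R : realType) (f g : nat -> \bar R) : Prop :=
  exists2 C : nat, (0 < C)%N &
    forall n : nat, (0 < n)%N -> (f n <= C%:R%:E * g (C * n)%N)%E.

(* Main.v *)
Require Import Defs.
From HB Require Import structures.
From mathcomp Require Import all_boot all_order all_algebra all_fingroup.
From mathcomp Require Import boolp classical_sets reals constructive_ereal ereal.
From mathcomp Require Import cyclic generic_quotient zify.

(** The argument runs along a chain G = H_0 >= H_1 >= ... >= H_h = 1 in which
    [H_i, G] <= H_(i+1) and H_i is generated by a single element z_i modulo
    H_(i+1) ([nilpotent_has_chain]).

    Let x and y be two elements that are not conjugate, and let i be the level
    at which they cease to be so: x^-1 y^g lies in H_i for some g, and then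
    x^-1 y^g = z_i^t modulo H_(i+1), but no conjugate of y is equal to x modulo
    H_(i+1). Let C_i be the group of the elements that commute with x modulo
    H_i. As H_i is central modulo H_(i+1), the map c |-> [x, c] is a
    homomorphism from C_i to H_i / H_(i+1). The exponents of z_i that occur in
    its image form a subgroup m Z of Z, and non-conjugacy means that - t is not
    in m Z. Put e = m if m > 0, and e = |t| + 1 otherwise; then - t is not in
    m Z + e Z either. Hence x and y stay non-conjugate in the image of a
    homomorphism f : G -> Q to a finite group as soon as
    - the kernel of f meets H_i inside <z_i^e> H_(i+1), and
    - an element that commutes with x modulo H_i ker f is a product of an
      element of C_i and of one in a kernel with the first property.

    Quotients with the first property, of order polynomial in e, are built
    from the bottom of the chain, by adjoining at each level a power of z_i
    that is central modulo what has been built ([deep_finite_quotient]). The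
    second property is obtained by going to a deeper quotient, whose order is
    polynomial in the order of the given one and in the numbers m of the
    levels before i ([centralizer_control]).

    It remains to bound m and t polynomially in the lengths of x and y. An
    element of H_i of length n has a z_i-coordinate of size polynomial in n
    ([coord_distortion]), so it is enough that C_i is generated by elements of
    polynomial length ([cen_generatedS]) and that g can be chosen of polynomial
    length ([short_conjugator]). Both the distortion bound and the generation
    of C_(i+1) from that of C_i come from one collection process
    ([collect_power]): the powers of one element z are moved to the left of a
    word, and a conjugate s^(z^a) is a product of at most (|a| + 1)^h iterated
    commutators of s with z. *)

Set Implicit Arguments.
Unset Strict Implicit.
Unset Printing Implicit Defensive.

(** * Subgroups and quotients of infinite groups *)

Notation ghom := UMagmaMorphism.type.

Section Subgroups.
Local Open Scope group_scope.
Local Open Scope classical_set_scope.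
Variable G : groupType.
Implicit Types (H K : set G) (x y g : G).

Lemma subgroupP H : subgroup H <->
  [/\ H 1, forall x y, H x -> H y -> H (x * y) & forall x, H x -> H x^-1].
Proof.
have mE x : (x \in [in H]) = `[< H x >] by [].
split=> [sH | [H1 HM HV]].
  have /= HV := group_closedV sH; have HM := group_closedM sH.
  split=> [|x y Hx Hy|x Hx].
  - by apply/asboolP; rewrite -mE; case: sH.
  - by apply/asboolP; rewrite -mE; apply: HM; rewrite mE; apply/asboolP.
  - by apply/asboolP; rewrite -mE; apply: HV; rewrite mE; apply/asboolP.
split=> [|x y]; rewrite !mE; first exact/asboolP.
by move=> /asboolP Hx /asboolP Hy; apply/asboolP/HM/HV.
Qed.

Lemma subgroup1 H : subgroup H -> H 1.
Proof. by case/subgroupP. Qed.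

Lemma subgroupM H x y : subgroup H -> H x -> H y -> H (x * y).
Proof. by move=> /subgroupP[_ h _]; apply: h. Qed.

Lemma subgroupV H x : subgroup H -> H x -> H x^-1.
Proof. by move=> /subgroupP[_ _ h]; apply: h. Qed.

Lemma subgroupMl H x y : subgroup H -> H x -> H (x * y) <-> H y.
Proof.
move=> sH Hx; split=> [Hxy|]; last exact: subgroupM.
by rewrite -(mulKg x y); apply: subgroupM => //; apply: subgroupV.
Qed.

Lemma subgroupMr H x y : subgroup H -> H x -> H (y * x) <-> H y.
Proof.
move=> sH Hx; split=> [Hxy|Hy]; last exact: subgroupM.
by rewrite -(mulgK x y); apply: subgroupM => //; apply: subgroupV.
Qed.

Definition normal_subgroup H :=
  subgroup H /\ forall x g, H x -> H (x ^ g).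

End Subgroups.

Section QuotientConstruction.
Local Open Scope group_scope.
Local Open Scope quotient_scope.
Variables (G : groupType) (N : set G) (nN : normal_subgroup N).

Let sN : subgroup N := proj1 nN.

Definition same_coset (x y : G) : bool := `[< N (x^-1 * y) >].

Lemma same_coset_equiv : equiv_class_of same_coset.
Proof.
split=> [x|x y|y x z]; first by apply/asboolP; rewrite mulVg; apply: subgroup1.
  by apply/asboolP/asboolP => /(subgroupV sN); rewrite invgM invgK.
move=> /asboolP Nxy /asboolP Nyz; apply/asboolP.
by rewrite -(mulgK y x^-1) -mulgA; apply: subgroupM.
Qed.

Canonical same_coset_rel := EquivRelPack same_coset_equiv.

Definition coset_space := {eq_quot same_coset_rel}.
HB.instance Definition _ := Choice.on coset_space.

Definition to_coset (x : G) : coset_space := \pi_coset_space x.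

Lemma to_coset_eq x y : to_coset x = to_coset y <-> N (x^-1 * y).
Proof.
split=> [/eqP|Nxy]; first by rewrite eqmodE => /asboolP.
by apply/eqP; rewrite eqmodE; apply/asboolP.
Qed.

Lemma repr_cosetK (p : coset_space) : to_coset (repr p) = p.
Proof. exact: reprK. Qed.

Definition coset_mul (p q : coset_space) := to_coset (repr p * repr q).
Definition coset_inv (p : coset_space) := to_coset (repr p)^-1.

Lemma to_cosetM x y : to_coset (x * y) = coset_mul (to_coset x) (to_coset y).
Proof.
have /to_coset_eq Nx := repr_cosetK (to_coset x).
have /to_coset_eq Ny := repr_cosetK (to_coset y).
apply/esym/to_coset_eq; rewrite invgM -mulgA.
rewrite (_ : _ * _ = ((repr (to_coset x))^-1 * x) ^ (repr (to_coset y)) *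
  ((repr (to_coset y))^-1 * y)); last by rewrite /conjg !gnorm.
by apply: subgroupM => //; apply: (proj2 nN).
Qed.

Lemma to_cosetV x : to_coset x^-1 = coset_inv (to_coset x).
Proof.
have /esym/to_coset_eq Nx := repr_cosetK (to_coset x).
apply/esym/to_coset_eq; rewrite invgK.
rewrite (_ : _ * _ = (x^-1 * repr (to_coset x)) ^ x^-1); last first.
  by rewrite /conjg !gnorm.
exact: (proj2 nN).
Qed.

Lemma coset_mulA : associative coset_mul.
Proof.
move=> p q r; rewrite -(repr_cosetK p) -(repr_cosetK q) -(repr_cosetK r).
by rewrite -!to_cosetM mulgA.
Qed.

Lemma coset_mul1 : left_id (to_coset 1) coset_mul.
Proof. by move=> p; rewrite -(repr_cosetK p) -to_cosetM mul1g. Qed.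

Lemma coset_1mul : right_id (to_coset 1) coset_mul.
Proof. by move=> p; rewrite -(repr_cosetK p) -to_cosetM mulg1. Qed.

Lemma coset_mulV : left_inverse (to_coset 1) coset_inv coset_mul.
Proof. by move=> p; rewrite -(repr_cosetK p) -to_cosetV -to_cosetM mulVg. Qed.

Lemma coset_Vmul : right_inverse (to_coset 1) coset_inv coset_mul.
Proof. by move=> p; rewrite -(repr_cosetK p) -to_cosetV -to_cosetM mulgV. Qed.

HB.instance Definition _ := isGroup.Build coset_space
  coset_mulA coset_mul1 coset_1mul coset_mulV coset_Vmul.

HB.instance Definition _ := isUMagmaMorphism.Build G coset_space to_coset
  (conj (erefl _) to_cosetM).

End QuotientConstruction.

Section Quotients.
Local Open Scope group_scope.
Variable G : groupType.

(** Congruences modulo N are treated below as equalities between images under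
    such a morphism. *)
Lemma quotient_exists (N : set G) : normal_subgroup N ->
  exists (P : groupType) (f : ghom G P),
    (forall p, exists g, f g = p) /\ (forall g, f g = 1 <-> N g).
Proof.
move=> nN; exists (coset_space nN), (to_coset nN); split=> [p|g].
  by exists (repr p); apply: repr_cosetK.
split=> [/esym/to_coset_eq|Ng]; first by rewrite invg1 mul1g.
by apply/esym/to_coset_eq; rewrite invg1 mul1g.
Qed.

(** T may meet a coset several times; this only weakens the bound. *)
Lemma finite_quotient (N : set G) (T : seq G) : normal_subgroup N ->
  (forall g, exists2 t, t \in T & N (t^-1 * g)) ->
  exists (Q : finGroupType) (f : ghom G Q),
    (#|Q| <= size T)%N /\ (forall g, f g = 1 <-> N g).
Proof.
move=> nN covT; have [P [f [fsurj fker]]] := quotient_exists nN.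
pose e := undup (map f T).
have eP (p : P) : p \in e.
  have [g <-] := fsurj p; have [t tT Ntg] := covT g.
  rewrite mem_undup; apply/mapP; exists t => //.
  by move: Ntg => /fker; rewrite gmulfM gmulfV => /mulg1_eq; rewrite invgK.
have eF : Finite.axiom e.
  by move=> p; rewrite count_uniq_mem ?undup_uniq // eP.
have eK : pcancel (index^~ e) (onth e).
  by move=> p; rewrite onthE (nth_map (1 : P)) ?index_mem // nth_index.
pose C : Countable.type := HB.pack (Group.sort P) (PCanIsCountable eK).
pose Q : finGroupType :=
  HB.pack (Group.sort P) (PCanIsCountable eK) (isFinite.Build C eF).
exists Q, f; split=> //.
have -> : #|Q| = size e by rewrite cardT enumT unlock.
by rewrite (leq_trans (size_undup _)) // size_map.
Qed.
End Quotients.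

(** * Integer powers *)

Section IntegerPowers.
Local Open Scope group_scope.
Variable G : groupType.
Implicit Types (x y : G) (a b : int).

Definition expgz x a : G :=
  match a with Posz n => x ^+ n | Negz n => x ^- n.+1 end.
Local Notation "x ^+z a" := (expgz x a) (at level 29, left associativity).

Lemma expgz_subn x (m n : nat) : x ^+z (m%:Z - n%:Z)%R = x ^+ m * x ^- n.
Proof.
have [le_nm|lt_mn] := leqP n m.
  by rewrite -(subnK le_nm) PoszD GRing.addrK expgnDr mulgK.
have -> : (m%:Z - n%:Z = Negz (n - m).-1)%R by lia.
rewrite /= prednK ?subn_gt0 // -[in RHS](subnK (ltnW lt_mn)) expgnDr invgM.
by rewrite mulVKg.
Qed.

Lemma expgzD x a b : x ^+z (a + b)%R = x ^+z a * x ^+z b.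
Proof.
have xC i j : commute (x ^+ i) (x ^- j) by apply/commuteV/commuteX2.
have eD (i j k l : nat) : x ^+z ((i%:Z - j%:Z) + (k%:Z - l%:Z))%R =
    x ^+z (i%:Z - j%:Z)%R * x ^+z (k%:Z - l%:Z)%R.
  have -> : (i%:Z - j%:Z + (k%:Z - l%:Z) = (i + k)%:Z - (l + j)%:Z)%R by lia.
  rewrite !expgz_subn !expgnDr invgM -!mulgA; congr (_ * _).
  by rewrite !mulgA -(xC k j).
have eZ (c : int) : exists i j : nat, c = (i%:Z - j%:Z)%R.
  by case: c => n; [exists n, 0%N | exists 0%N, n.+1]; lia.
by have [i [j ->]] := eZ a; have [k [l ->]] := eZ b; apply: eD.
Qed.

Lemma expgzN x a : x ^+z (- a)%R = (x ^+z a)^-1.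
Proof. by apply/esym/mulg1_eq; rewrite -expgzD GRing.subrr. Qed.

Lemma expgzM x a b : x ^+z (a * b)%R = (x ^+z a) ^+z b.
Proof.
have expgzMn c n : x ^+z (c * n%:Z)%R = (x ^+z c) ^+z n%:Z.
  elim: n => [|n IHn]; first by rewrite GRing.mulr0.
  by rewrite -addn1 PoszD GRing.mulrDr GRing.mulr1 !expgzD IHn.
case: b => n; first exact: expgzMn.
by rewrite NegzE GRing.mulrN !expgzN expgzMn.
Qed.

Lemma conjXz x y a : (x ^+z a) ^ y = (x ^ y) ^+z a.
Proof. by case: a => n; rewrite /= ?conjVg conjXg. Qed.

Lemma commuteXz x y a : commute x y -> commute x (y ^+z a).
Proof.
by case: a => n xy /=; [apply: commuteX | apply/commuteV/commuteX].
Qed.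

Lemma expgzMn x y a : commute x y -> (x * y) ^+z a = x ^+z a * y ^+z a.
Proof.
move=> xy; case: a => n /=; first exact: expgMn.
by rewrite expgMn // invgM; apply/commuteV/commute_sym/commuteV/commuteX2.
Qed.

Lemma subgroupXz (H : set G) x a : subgroup H -> H x -> H (x ^+z a).
Proof.
move=> sH Hx; have HX n : H (x ^+ n).
  by elim: n => [|n IHn]; [apply: subgroup1|rewrite expgS; apply: subgroupM].
by case: a => n //=; apply: subgroupV.
Qed.

End IntegerPowers.

Notation "x ^+z a" := (expgz x a)
  (at level 29, left associativity) : group_scope.

Section MorphismPowers.
Local Open Scope group_scope.

Lemma gmulfXz (G P : groupType) (f : ghom G P) x a :
  f (x ^+z a) = f x ^+z a.
Proof. by case: a => n; rewrite /= ?gmulfV gmulfXn. Qed.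

End MorphismPowers.

Section FiniteKernels.
Local Open Scope group_scope.
Variable G : groupType.
Implicit Types (x g u : G) (a : int).

Lemma ghom_pair (Q1 Q2 : finGroupType) (f1 : ghom G Q1) (f2 : ghom G Q2) :
  exists (Q : finGroupType) (f : ghom G Q), #|Q| = (#|Q1| * #|Q2|)%N /\
    forall g, f g = 1 <-> f1 g = 1 /\ f2 g = 1.
Proof.
pose f g : (Q1 * Q2)%type := (f1 g, f2 g).
have f1E : f 1 = 1 by rewrite /f !gmulf1.
have fM : {morph f : x y / x * y} by move=> x y; rewrite /f !gmulfM.
pose F : ghom G (Q1 * Q2)%type :=
  HB.pack f (isUMagmaMorphism.Build G (Q1 * Q2)%type f (conj f1E fM)).
exists (Q1 * Q2)%type, F; split; first by rewrite card_prod.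
by move=> g; split=> [[-> ->]|[e1 e2]] //; rewrite /= /f e1 e2.
Qed.

(** Lagrange's theorem in Q: the kernel contains all powers of exponent #|Q|. *)
Lemma ker_card (Q : finGroupType) (f : ghom G Q) g a :
  f (g ^+z (Posz #|Q| * a)%R) = 1.
Proof.
rewrite expgzM gmulfXz /= gmulfXn.
have -> : f g ^+ #|Q| = 1.
  by have := @expg_cardG Q (setT_group Q) (f g) (finset.in_setT _); rewrite cardsT.
by case: a => n /=; rewrite expg1n ?invg1.
Qed.

Lemma ker_comm (Q : finGroupType) (f : ghom G Q) x u : f u = 1 -> f [~ x, u] = 1.
Proof. by move=> fu; rewrite gmulfR fu commg1. Qed.

End FiniteKernels.

(** * Balls and the subgroups they exhaust *)

Section Balls.
Local Open Scope group_scope.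
Variable G : groupType.
Implicit Types (X Y : set G) (x y g : G) (m n : nat).

Definition letter X s := X s \/ X s^-1.

(** X may be infinite: the generating sets of centralizers used below are
    intersections of a subgroup with a ball. *)
Definition ball X n : set G := [set g | exists w : seq G,
  [/\ {in w, forall s, letter X s}, (size w <= n)%N & \prod_(s <- w) s = g]].

Definition generated X : set G := [set g | exists n, ball X n g].

Lemma ball1 X n : ball X n 1.
Proof. by exists [::]; split=> //; rewrite big_nil. Qed.

Lemma ball_gen X x : X x -> ball X 1 x.
Proof.
move=> Xx; exists [:: x]; split=> //; last by rewrite big_seq1.
by move=> s; rewrite inE => /eqP->; left.
Qed.

Lemma ball_mono X m n g : (m <= n)%N -> ball X m g -> ball X n g.
Proof. by move=> le_mn [w [wX sw wg]]; exists w; split=> //; apply: leq_trans le_mn. Qed.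

Lemma ballM X m n g h : ball X m g -> ball X n h -> ball X (m + n) (g * h).
Proof.
move=> [v [vX sv <-]] [w [wX sw <-]]; exists (v ++ w); split.
- by move=> s; rewrite mem_cat => /orP[/vX|/wX].
- by rewrite size_cat leq_add.
- by rewrite big_cat.
Qed.

Lemma ballV X n g : ball X n g -> ball X n g^-1.
Proof.
move=> [w [wX sw <-]]; exists (rev ([seq s^-1 | s <- w])); split.
- move=> s; rewrite mem_rev => /mapP[t /wX tX ->].
  by case: tX => tX; [right; rewrite invgK | left].
- by rewrite size_rev size_map.
- elim: w {wX sw} => [|s w IHw]; first by rewrite !big_nil invg1.
  by rewrite map_cons rev_cons -cats1 big_cat /= big_seq1 big_cons IHw invgM.
Qed.

Lemma ballX X n g k : ball X n g -> ball X (k * n) (g ^+ k).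
Proof.
move=> gX; elim: k => [|k IHk]; first exact: ball1.
by rewrite expgS mulSn; apply: ballM.
Qed.

Lemma ballXz X n g a : ball X n g -> ball X (`|a| * n) (g ^+z a).
Proof. by case: a => k gX /=; [|apply: ballV]; apply: ballX. Qed.

Lemma ballJ X m n g h : ball X m g -> ball X n h -> ball X (m + n.*2) (g ^ h).
Proof.
move=> gX hX; apply: (@ball_mono _ (n + (m + n))); first by lia.
by apply: ballM (ballV hX) (ballM gX hX).
Qed.

Lemma ballR X m n g h : ball X m g -> ball X n h ->
  ball X (m.*2 + n.*2) [~ g, h].
Proof.
move=> gX hX; apply: (@ball_mono _ (m + (m + n.*2))); first by lia.
by apply: ballM (ballV gX) (ballJ gX hX).
Qed.

Lemma ball_ind X (P : nat -> G -> Prop) : P 0%N 1 ->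
  (forall n s g, letter X s -> ball X n g -> P n g -> P n.+1 (s * g)) ->
  (forall m n g, (m <= n)%N -> P m g -> P n g) ->
  forall n g, ball X n g -> P n g.
Proof.
move=> P1 PS Pmono n g [w [wX sw <-]].
apply: Pmono sw _; elim: w wX => [|s w IHw] wX; first by rewrite big_nil.
rewrite big_cons /=; have wX' : {in w, forall s, letter X s}.
  by move=> t tw; apply: wX; rewrite inE tw orbT.
apply: PS; last exact: IHw.
  by apply: wX; rewrite mem_head.
by exists w.
Qed.

Lemma ball_sub X (H : set G) n g : subgroup H -> (forall x, X x -> H x) ->
  ball X n g -> H g.
Proof.
move=> sH XH; move: n g; apply: ball_ind => //; first exact: subgroup1.
move=> _ s g sX _ Hg; apply: subgroupM => //; case: sX => /XH //.
by move/(subgroupV sH); rewrite invgK.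
Qed.

Lemma ball_trans X Y m n g : (forall x, X x -> ball Y m x) ->
  ball X n g -> ball Y (n * m) g.
Proof.
move=> XY; move: n g; apply: ball_ind => [|n s g sX _ gY|k n g kn].
- exact: ball1.
- rewrite mulSn; apply: ballM => //; case: sX => /XY //.
  by move/ballV; rewrite invgK.
- by apply: ball_mono; rewrite leq_mul2r kn orbT.
Qed.

Lemma ball_subset X Y n g : (forall x, X x -> Y x) -> ball X n g -> ball Y n g.
Proof.
by move=> XY; rewrite -[n in ball Y n]muln1; apply: ball_trans => x /XY/ball_gen.
Qed.

Lemma generated_is_subgroup X : subgroup (generated X).
Proof.
apply/subgroupP; split; first by exists 0%N; apply: ball1.
  by move=> x y [m Xm] [n Xn]; exists (m + n)%N; apply: ballM.
by move=> x [m Xm]; exists m; apply: ballV.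
Qed.

Lemma generated_gen X x : X x -> generated X x.
Proof. by exists 1%N; apply: ball_gen. Qed.

Lemma generating_ball (S : seq G) : generating S ->
  forall g, exists n, ball [set` S] n g.
Proof.
move=> gS g; have : generated_subgroup [set` S] g by rewrite gS.
move=> /(_ (generated [set` S])); apply; split.
  exact: generated_is_subgroup.
by move=> x xS; apply: generated_gen.
Qed.

End Balls.

(** * Polynomial bounds *)

Section PolynomialBounds.

Lemma leq_expl d m n : (m <= n)%N -> (m ^ d <= n ^ d)%N.
Proof. by case: d => // d; rewrite leq_exp2r. Qed.

(** One-parameter family of bounds in which sums, products and composites of
    its members are absorbed at the price of a larger parameter, so that a
    polynomial bound is recorded by a single number. *)
Definition pbound K n := ((n + K) ^ K)%N.

Definition poly_bounded (f : nat -> nat) :=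
  exists K, forall n, (f n <= pbound K n)%N.

Lemma pbound_mono K m n : (m <= n)%N -> (pbound K m <= pbound K n)%N.
Proof. by move=> le_mn; apply: leq_expl; rewrite leq_add2r. Qed.

Lemma pbound_le K L n : (K <= L)%N -> (pbound K n <= pbound L n)%N.
Proof.
move=> KL; apply: (@leq_trans ((n + L) ^ K)); first by apply: leq_expl; rewrite leq_add2l.
by case: L KL => [|L] KL; [case: K KL | rewrite leq_pexp2l // addnS].
Qed.

Lemma poly_pbound K : poly_bounded (pbound K).
Proof. by exists K. Qed.

Lemma poly_le f g : (forall n, f n <= g n)%N -> poly_bounded g -> poly_bounded f.
Proof. by move=> fg [K gK]; exists K => n; apply: leq_trans (fg n) (gK n). Qed.

Lemma poly_power a b : poly_bounded (fun n => (n + a) ^ b)%N.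
Proof.
exists (a + b).+1 => n; apply: (@leq_trans ((n + (a + b).+1) ^ b)).
  by apply: leq_expl; lia.
by rewrite leq_pexp2l //; lia.
Qed.

Lemma poly_id : poly_bounded id.
Proof. by apply: poly_le (poly_power 0 1) => n; rewrite expn1 addn0. Qed.

Lemma poly_const c : poly_bounded (fun=> c).
Proof.
by apply: poly_le (poly_power c 1) => n; rewrite expn1 leq_addl.
Qed.

Lemma poly_add f g : poly_bounded f -> poly_bounded g ->
  poly_bounded (fun n => f n + g n)%N.
Proof.
move=> [K fK] [L gL]; apply: poly_le (poly_power (K + L).+2 (K + L).+1) => n.
apply: (@leq_trans (2 * (n + (K + L).+2) ^ (K + L))); last first.
  by rewrite expnS leq_mul2r; apply/orP; right; lia.
rewrite mul2n -addnn leq_add //.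
  apply: leq_trans (fK n) (leq_trans (pbound_le n (leq_addr L K)) _).
  by apply: leq_expl; lia.
apply: leq_trans (gL n) (leq_trans (pbound_le n (leq_addl K L)) _).
by apply: leq_expl; lia.
Qed.

Lemma poly_exp f k : poly_bounded f -> poly_bounded (fun n => f n ^ k)%N.
Proof.
move=> [K fK]; apply: poly_le (poly_power K (K * k)) => n.
by rewrite expnM; apply: leq_expl; apply: fK.
Qed.

Lemma poly_mul f g : poly_bounded f -> poly_bounded g ->
  poly_bounded (fun n => f n * g n)%N.
Proof.
move=> pf pg; apply: poly_le (poly_exp 2 (poly_add pf pg)) => n.
by rewrite expnS expn1 leq_mul // ?leq_addr ?leq_addl.
Qed.

Lemma poly_double f : poly_bounded f -> poly_bounded (fun n => (f n).*2).
Proof.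
by move=> pf; apply: poly_le (poly_mul pf (poly_const 2)) => n; rewrite muln2.
Qed.

Lemma poly_comp f g : poly_bounded f -> poly_bounded g ->
  poly_bounded (fun n => f (g n)).
Proof.
move=> [K fK] pg; apply: poly_le (poly_exp K (poly_add pg (poly_const K))) => n.
exact: fK.
Qed.

End PolynomialBounds.

(** * Central chains with cyclic factors *)

Section CentralChains.
Local Open Scope group_scope.
Local Open Scope classical_set_scope.
Variable G : groupType.
Implicit Types (A K : set G) (x y g : G) (S T : seq G).

(** Since H h is trivial, so are all the later terms; this is why no condition
    restricts the index. The factor H i / H i.+1 may be finite or infinite. *)
Record central_chain K (H : nat -> set G) (z : nat -> G) (h : nat) : Prop := {
  chain0 : H 0%N = K;
  chain_end : forall x, H h x -> x = 1;
  chain_subgroup : forall i, subgroup (H i);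
  chain_le : forall i x, H i.+1 x -> H i x;
  chain_comm : forall i x g, H i x -> H i.+1 [~ x, g];
  chain_gen : forall i, H i (z i);
  chain_cyclic : forall i x, H i x -> exists a : int, H i.+1 (z i ^+z (- a)%R * x)
}.

Definition has_chain K := exists H z h, central_chain K H z h.

Lemma has_chain1 : has_chain [set 1].
Proof.
exists (fun=> [set 1]), (fun=> 1), 0%N; split=> //.
- by move=> _; apply/subgroupP; split=> [|x y -> ->|x ->];
    rewrite /set1/mkset ?mulg1 ?invg1.
- by move=> _ x g ->; rewrite /set1/mkset comm1g.
- by move=> _ x ->; exists 0%R; rewrite /set1/mkset mulg1.
Qed.

Lemma has_chain_cons K K' t : has_chain K' -> subgroup K -> K' `<=` K -> K t ->
  (forall x g, K x -> K' [~ x, g]) ->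
  (forall x, K x -> exists a : int, K' (t ^+z (- a)%R * x)) -> has_chain K.
Proof.
move=> [H [z [h [H0 Hh sH Hle Hcomm Hz Hcyc]]]] sK K'K Kt Kcomm Kcyc.
exists (fun i => if i is j.+1 then H j else K).
exists (fun i => if i is j.+1 then z j else t), h.+1.
by split=> [|//|[]|[|i] x|[|i] x|[]|[|i] x]; rewrite ?H0; auto.
Qed.

Lemma generated_subgroup_sub A K : subgroup K -> A `<=` K ->
  generated_subgroup A `<=` K.
Proof. by move=> sK AK; apply: smallest_sub. Qed.

Lemma generated_subgroup_is_subgroup A : subgroup (generated_subgroup A).
Proof.
apply/subgroupP; split.
- by move=> K [sK _]; apply: subgroup1.
- by move=> x y Ax Ay K KA; apply: subgroupM (Ax K KA) (Ay K KA); case: KA.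
- by move=> x Ax K KA; apply: subgroupV (Ax K KA); case: KA.
Qed.

Lemma lcs_subgroup c : subgroup (lcs (G := G) c).
Proof.
case: c => [|c]; last exact: generated_subgroup_is_subgroup.
by apply/subgroupP.
Qed.

Lemma lcs_comm c x g : lcs c x -> lcs (G := G) c.+1 [~ x, g].
Proof. by move=> cx K [_]; apply; exists x => //; exists g. Qed.

Lemma lcs_conj c x g : lcs (G := G) c x -> lcs c (x ^ g).
Proof.
elim: c x g => [|c IHc] x g; first by move=> _; exact: I.
move: x; change (lcs (G := G) c.+1 `<=` [set x | lcs c.+1 (x ^ g)]).
apply: generated_subgroup_sub.
  apply/subgroupP; split=> [|u v|u]; rewrite /mkset.
  - by rewrite conj1g; apply: subgroup1 (lcs_subgroup _).
  - by rewrite conjMg; apply: subgroupM (lcs_subgroup _).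
  - by rewrite conjVg; apply: subgroupV (lcs_subgroup _).
by move=> _ [u cu] [v _ <-]; rewrite /mkset conjRg; apply: lcs_comm; apply: IHc.
Qed.

Lemma lcs_le c : lcs (G := G) c.+1 `<=` lcs c.
Proof.
apply: generated_subgroup_sub; first exact: lcs_subgroup.
move=> _ [u cu] [v _ <-]; apply: subgroupM (lcs_subgroup _) _ (lcs_conj v cu).
by apply: subgroupV (lcs_subgroup _) _.
Qed.

(** Modulo lcs c.+2 the commutator is a bilinear map on lcs c and G that
    vanishes on lcs c.+1, so the commutators of generators generate lcs c.+1
    modulo lcs c.+2. Generation modulo the next term is expressed by the
    subgroups K that contain this term. *)
Lemma lcs_finitely_generated S : generating S -> forall c, exists T : seq G,
  (forall t, t \in T -> lcs c t) /\
  forall K, subgroup K -> lcs c.+1 `<=` K -> [set` T] `<=` K -> lcs c `<=` K.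
Proof.
move=> genS; elim=> [|c [T [cT genT]]].
  exists S; split=> // K sK _ SK x _; have : generated_subgroup [set` S] x.
    by rewrite genS.
  exact: generated_subgroup_sub.
exists [seq [~ t, s] | t <- T, s <- S]; split=> [_ /allpairsP[[t s] /= [tT _ ->]]|].
  by apply: lcs_comm; apply: cT.
move=> K sK c2K TK; apply: generated_subgroup_sub => //.
have xsK : lcs c `<=` [set x | lcs c x /\ forall s, s \in S -> K [~ x, s]].
  apply: genT.
  - apply/subgroupP; split=> [|x y [cx xK] [cy yK]|x [cx xK]].
    + by split=> [|s _]; [apply: subgroup1 (lcs_subgroup c)
                        | rewrite comm1g; apply: subgroup1 sK].
    + split=> [|s sS]; first exact: subgroupM (lcs_subgroup c) _ _.
      rewrite (_ : [~ x * y, s] = [~ x, s] * [~ [~ x, s], y] * [~ y, s]).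
        apply: subgroupM (yK s sS) => //; apply: subgroupM (xK s sS) _ => //.
        by apply: c2K; do 2 apply: lcs_comm.
      by rewrite /commg /conjg !gnorm.
    + split=> [|s sS]; first exact: subgroupV (lcs_subgroup c) _.
      rewrite (_ : [~ x^-1, s] = [~ x, s]^-1 * [~ [~ x, s]^-1, x^-1]).
        apply: subgroupM (subgroupV _ (xK s sS)) _ => //.
        apply: c2K; apply: lcs_comm; apply: subgroupV (lcs_subgroup _) _; exact: lcs_comm.
      by rewrite /commg /conjg !gnorm.
  - move=> x cx; split=> [|s _]; first exact: lcs_le.
    by apply: c2K; apply: lcs_comm.
  - move=> t tT; split=> [|s sS]; first exact: cT.
    by apply: TK => /=; apply/allpairsP; exists (t, s).
have yK : setT `<=` [set y | forall x, lcs c x -> K [~ x, y]].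
  rewrite -genS; apply: generated_subgroup_sub; last first.
    by move=> s sS x /xsK[_]; apply.
  apply/subgroupP; split=> [x _|y y' Ky Ky' x cx|y Ky x cx].
  - by rewrite commg1; apply: subgroup1 sK.
  - rewrite (_ : [~ x, y * y'] = [~ x, y'] * [~ x, y] * [~ [~ x, y], y']).
      apply: subgroupM => //; last by apply: c2K; do 2 apply: lcs_comm.
      by apply: subgroupM => //; [apply: Ky' | apply: Ky].
    by rewrite /commg /conjg !gnorm.
  - rewrite (_ : [~ x, y^-1] = [~ x, y]^-1 * [~ [~ x, y]^-1, y^-1]).
      apply: subgroupM (subgroupV _ (Ky x cx)) _ => //.
      by apply: c2K; apply: lcs_comm; apply: subgroupV (lcs_subgroup _) _; exact: lcs_comm.
    by rewrite /commg /conjg !gnorm.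
by move=> _ [x cx] [y _ <-]; apply: yK.
Qed.

(** The elements of T are adjoined one at a time. Each of them is central
    modulo lcs c.+1, which makes every intermediate set a subgroup with a
    cyclic central factor. *)
Lemma has_chain_lcs c T : (forall t, t \in T -> lcs c t) ->
  has_chain (lcs (G := G) c.+1) -> exists K,
  [/\ has_chain K, subgroup K, lcs c.+1 `<=` K, K `<=` lcs c & [set` T] `<=` K].
Proof.
move=> cT chc; elim: T cT => [|t T IHT] cT.
  by exists (lcs c.+1); split=> //; [apply: lcs_subgroup | apply: lcs_le].
case: IHT => [u uT|K' [chK' sK' cK' K'c TK']]; first by apply: cT; rewrite inE uT orbT.
have ct : lcs c t by apply: cT; rewrite mem_head.
pose K := [set x | exists a : int, K' (t ^+z (- a)%R * x)].
have K'K : K' `<=` K by move=> x K'x; exists 0%R; rewrite mul1g.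
have Kc : K `<=` lcs c.
  move=> x [a /K'c ax]; rewrite -(mulKg (t ^+z (- a)%R) x).
  apply: (subgroupM (lcs_subgroup c)) ax; apply: (subgroupV (lcs_subgroup c)).
  by apply: subgroupXz (lcs_subgroup c) _.
have sK : subgroup K.
  apply/subgroupP; split=> [|x y Kx Ky|x Kx].
  - by exists 0%R; rewrite mulg1; apply: subgroup1.
  - have [a ax] := Kx; have [b bY] := Ky; exists (a + b)%R.
    rewrite (_ : _ * _ = (t ^+z (- a)%R * x) *
        [~ t ^+z (- a)%R * x, t ^+z b] * (t ^+z (- b)%R * y)).
      apply: subgroupM => //; apply: subgroupM => //.
      by apply: cK'; apply: lcs_comm; apply: K'c.
    rewrite GRing.opprD GRing.addrC !expgzD !expgzN /commg /conjg !gnorm.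
    by [].
  - have [a ax] := Kx; exists (- a)%R.
    rewrite (_ : _ * _ = (t ^+z (- a)%R * x)^-1 *
        [~ (t ^+z (- a)%R * x)^-1, t ^+z (- a)%R]).
      apply: subgroupM => //; first exact: subgroupV.
      by apply: cK'; apply: lcs_comm; apply: K'c; apply: subgroupV.
    by rewrite /commg /conjg !expgzN !gnorm.
exists K; split=> //; last 1 first.
- move=> u /=; rewrite inE => /predU1P[->|uT]; last exact/K'K/TK'.
  by exists 1%R; rewrite expgzN mulVg; apply: subgroup1.
- apply: (@has_chain_cons K K' t) => //.
  + by exists 1%R; rewrite expgzN mulVg; apply: subgroup1.
  + by move=> x g /Kc cx; apply: cK'; apply: lcs_comm.
- by move=> x /cK'/K'K.
Qed.

Theorem nilpotent_has_chain : finitely_generated G -> nilpotent_group G ->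
  exists H z h, central_chain setT H z h.
Proof.
move=> [S genS] [c cE]; have chd d : (d <= c)%N -> has_chain (lcs (c - d)).
  elim: d => [_|d IHd ltdc]; first by rewrite subn0 cE; apply: has_chain1.
  have cd : (c - d = (c - d.+1).+1)%N by lia.
  have := IHd (ltnW ltdc); rewrite cd => chd.
  have [T [cT genT]] := lcs_finitely_generated genS (c - d.+1).
  have [K [chK sK cK Kc TK]] := has_chain_lcs cT chd.
  by rewrite (_ : lcs _ = K) //; apply/seteqP; split=> //; apply: genT.
by have := chd c (leqnn c); rewrite subnn.
Qed.

End CentralChains.

(** * Sums of bounded integers *)

Section Integers.
Local Open Scope ring_scope.
Import GRing.Theory Num.Theory Order.TTheory.

Lemma int_subgroup_principal (J : int -> Prop) :
  J 0 -> (forall a b, J a -> J b -> J (a + b)) -> (forall a, J a -> J (- a)) ->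
  exists m : nat, forall t, J t <-> exists k : int, t = k * m%:Z.
Proof.
move=> J0 JD JN.
have JM k t : J t -> J (k * t).
  move=> Jt; have JMn (n : nat) : J (n%:Z * t).
    by elim: n => [|n IHn]; [rewrite mul0r | rewrite intS mulrDl mul1r; apply: JD].
  by case: k => n; [|rewrite NegzE mulNr; apply: JN]; apply: JMn.
have [[m Jm]|J'] := pselect (exists m : nat, (0 < m)%N && `[< J m%:Z >]); last first.
  exists 0%N => t; split=> [Jt|[k ->]]; last by rewrite mulr0.
  exists 0; rewrite mul0r; have [//|t0] := eqVneq t 0; case: J'.
  exists `|t|%N; rewrite absz_gt0 t0; apply/asboolP.
  by rewrite abszE; case: (ger0P t) => _; [|apply: JN].
have {m Jm} exJ : exists m, (0 < m)%N && `[< J m%:Z >] by exists m.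
have [m /andP[m0 /asboolP Jm] minm] := ex_minnP exJ.
exists m => t; split=> [Jt|[k ->]]; last exact: JM.
exists (t %/ m)%Z; rewrite {1}(divz_eq t m).
suff -> : (t %% m)%Z = 0 by rewrite addr0.
have Jr : J (t %% m)%Z.
  by rewrite /modz -mulNr; apply: JD => //; apply: JM.
have r0 : 0 <= (t %% m)%Z by rewrite modz_ge0 // eqz_nat -lt0n.
have rm : (t %% m)%Z < m by rewrite ltz_pmod.
move: Jr r0 rm; case: (t %% m)%Z => // [[|r]] // Jr _ rm.
have := minm r.+1; rewrite /= => /(_ (introT (asboolP _) Jr)).
by rewrite leqNgt -ltz_nat rm.
Qed.

(** If l has more than a entries, two of its prefix sums agree modulo a, and
    the entries between them can be removed. *)
Lemma short_sum_modulo (a : nat) (T : int -> Prop) (l : seq int) : (0 < a)%N ->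
  {in l, forall t, T t} -> exists l' : seq int,
  [/\ {in l', forall t, T t}, (size l' <= a)%N
    & exists k : int, \sum_(t <- l) t = k * a%:Z + \sum_(t <- l') t].
Proof.
move=> a0; have [n] := ubnP (size l); elim: n l => // n IHn l ltn lT.
have [le_la|lt_al] := leqP (size l) a.
  by exists l; split=> //; exists 0; rewrite mul0r add0r.
pose p i := \sum_(t <- take i l) t.
have pa i : (`|(p i %% a)%Z| < a)%N.
  rewrite -ltz_nat gez0_abs ?modz_ge0 ?ltz_pmod // eqz_nat; lia.
pose f (i : 'I_a.+1) : 'I_a := Ordinal (pa i).
have /injectivePn[i [j neq_ij eq_ij]] : ~~ injectiveb f.
  by apply/injectiveP => /leq_card; rewrite !card_ord ltnn.
wlog lt_ij : i j neq_ij eq_ij / (i < j)%N.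
  move=> wlog_ij; case: (ltngtP i j) => [lt_ij|lt_ji|/val_inj eqij].
  - exact: (wlog_ij i j).
  - by apply: (wlog_ij j i) => //; rewrite eq_sym.
  - by rewrite eqij eqxx in neq_ij.
have jl : (j <= size l)%N by have := ltn_ord j; lia.
have [|t|l' [l'T l'a [k ek]]] := IHn (take i l ++ drop j l).
- by rewrite size_cat size_takel ?size_drop; lia.
- by rewrite mem_cat => /orP[/mem_take|/mem_drop]; apply: lT.
have : (p j == p i %[mod a])%Z.
  move/(congr1 (@nat_of_ord a)): eq_ij => /= eq_ij.
  have a0Z : a%:Z != 0 by rewrite eqz_nat; lia.
  rewrite -(gez0_abs (modz_ge0 (p j) a0Z)) -(gez0_abs (modz_ge0 (p i) a0Z)).
  by rewrite [in eqbRHS]eq_ij.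
rewrite eqz_mod_dvd => /dvdzP[q eq_q].
exists l'; split=> //; exists (q + k).
have el : \sum_(t <- l) t = p j + \sum_(t <- drop j l) t.
  by rewrite -big_cat cat_take_drop.
rewrite el -[p j](subrK (p i)) eq_q mulrDl -!addrA; congr (_ + _).
by rewrite -ek big_cat.
Qed.

(** A substitute for a Bezout identity with small coefficients: some nonzero
    element of T serves as a modulus for shortening l, and copies of it or of
    its opposite restore the sum. *)
Lemma short_sum (A : nat) (T : int -> Prop) (l : seq int) :
  (forall t, T t -> (`|t| <= A)%N) -> (forall t, T t -> T (- t)) ->
  {in l, forall t, T t} -> exists l' : seq int,
  [/\ {in l', forall t, T t}, \sum_(t <- l') t = \sum_(t <- l) t
    & (size l' <= `|(\sum_(t <- l) t)%R| + A * A + A)%N].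
Proof.
move=> TA TN lT; have [[a [Ta a0]]|T0] := pselect (exists a, T a /\ a != 0); last first.
  exists [::]; split=> //; rewrite big_nil big_seq big1 // => t /lT Tt.
  by have [//|t0] := eqVneq t 0; case: T0; exists t.
have {a Ta a0} [a Ta a0] : exists2 a : nat, T a%:Z & (0 < a)%N.
  by exists `|a|%N; rewrite ?absz_gt0 // abszE; case: (ger0P a) => _ //; apply: TN.
have aA := TA _ Ta.
have [l1 [l1T l1a [k ek]]] := short_sum_modulo a0 lT.
have s1 : (`|(\sum_(t <- l1) t)%R| <= A * A)%N.
  apply: (@leq_trans (size l1 * A)); last by rewrite leq_mul2r; lia.
  elim: l1 l1T {l1a ek} => [|t l1 IHl] l1T; first by rewrite big_nil.
  rewrite big_cons mulSn; have := TA t (l1T _ (mem_head _ _)).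
  have := IHl (fun u ul => l1T u (@mem_behead _ (t :: l1) u ul)).
  move: (\sum_(u <- l1) u) => u; move: (size l1 * A)%N => c; lia.
have kb : (`|k| <= `|(\sum_(t <- l) t)%R| + A * A)%N.
  rewrite (_ : \sum_(t <- l1) t = \sum_(t <- l) t - k * a%:Z) in s1; last by lia.
  nia.
exists (nseq `|k| (if 0 <= k then a%:Z else - a%:Z) ++ l1); split.
- move=> t; rewrite mem_cat => /orP[|/l1T //].
  by rewrite mem_nseq => /andP[_ /eqP->]; case: ifP => _ //; apply: TN.
- rewrite ek big_cat /=; congr (_ + _); rewrite big_nseq.
  rewrite iter_addr_0 -mulr_natr; case: ifP; lia.
- by rewrite size_cat size_nseq; lia.
Qed.

End Integers.

(** * Collecting the powers of one element *)

Section Collection.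
Local Open Scope group_scope.
Variable G : groupType.
Implicit Types (X Y : set G) (x y z s g : G).

Definition icomm z j s : G := iter j (fun t => [~ t, z]) s.

Lemma icommSr z j s : icomm z j.+1 s = icomm z j [~ s, z].
Proof. exact: iterSr. Qed.

(** As s ^ z = s [s, z], conjugation by z turns each iterated commutator of s
    with z into the product of itself and of the next one. The number of
    letters thus obeys Pascal's rule. *)
Lemma conj_power_ball X z d s k : (forall j, X (icomm z j s)) ->
  icomm z d s = 1 -> ball X (k.+1 ^ d) (s ^ (z ^+ k)).
Proof.
elim: d s k => [|d IHd] s k Xs.
  by rewrite /icomm /= => ->; rewrite conj1g; apply: ball1.
rewrite icommSr => szd; have Xsz j : X (icomm z j [~ s, z]).
  by rewrite -icommSr.
elim: k => [|k IHk]; first by rewrite exp1n conjg1; apply: ball_gen (Xs 0%N).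
apply: (@ball_mono _ _ (k.+1 ^ d.+1 + k.+1 ^ d)).
  rewrite [in leqRHS]expnS [in leqLHS]expnS -mulSnr leq_mul2l.
  by apply/orP; right; apply: leq_expl.
rewrite expgS conjgM (_ : s ^ z = s * [~ s, z]); last first.
  by rewrite commgEl mulVKg.
by rewrite conjMg; apply: ballM => //; apply: IHd.
Qed.

Lemma conj_powerz_ball X z d s a :
  (forall j, X (icomm z j s)) -> (forall j, X (icomm z^-1 j s)) ->
  icomm z d s = 1 -> icomm z^-1 d s = 1 ->
  ball X (`|a|.+1 ^ d) (s ^ (z ^+z a)).
Proof.
case: a => n X1 X2 d1 d2 /=; first exact: conj_power_ball.
by rewrite -expVgn; apply: conj_power_ball.
Qed.

(** Moving the powers of z to the left of a word of length n conjugates each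
    remaining letter by some z ^+z b with |b| <= A n. *)
Lemma collect_power X Y z A d :
  (forall x, X x -> exists a : int, let x' := z ^+z (- a)%R * x in
     [/\ (`|a| <= A)%N, forall j, Y (icomm z j x') /\ Y (icomm z^-1 j x'),
       icomm z d x' = 1 & icomm z^-1 d x' = 1]) ->
  forall n g, ball X n g -> exists (t : int) v,
    [/\ (`|t| <= A * n)%N, g = z ^+z t * v & ball Y (n * (A * n).+1 ^ d) v].
Proof.
move=> XY; apply: ball_ind => [|n s g sX _ [t [v [tA -> vY]]]|m n g mn [t [v [tA -> vY]]]].
- by exists 0%R, 1; split; rewrite ?mulg1 //; apply: ball1.
- have conjY a x' (u : int) : (`|u| <= A * n.+1)%N ->
      (forall j, Y (icomm z j x') /\ Y (icomm z^-1 j x')) ->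
      icomm z d x' = 1 -> icomm z^-1 d x' = 1 ->
      a \in [:: x' ^ (z ^+z u); (x' ^ (z ^+z u))^-1] ->
      ball Y (n.+1 * (A * n.+1).+1 ^ d) (a * v).
    move=> uA Yx d1 d2 ea; rewrite mulSn; apply: ballM.
      apply: (@ball_mono _ _ (`|u|.+1 ^ d)).
        exact: leq_expl.
      have bx : ball Y (`|u|.+1 ^ d) (x' ^ (z ^+z u)).
        by apply: conj_powerz_ball => // j; case: (Yx j).
      by move: ea; rewrite !inE => /orP[]/eqP-> //; apply: ballV.
    apply: ball_mono vY; rewrite leq_mul2l; apply/orP; right.
    by apply: leq_expl; rewrite ltnS leq_mul2l leqnSn orbT.
  case: sX => /XY[a []] /=; set x' := _ * _ => aA Yx d1 d2.
  + have es : s = z ^+z a * x' by rewrite /x' expgzN mulVKg.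
    exists (a + t)%R, (x' ^ (z ^+z t) * v); split; first by rewrite mulnS; lia.
      by rewrite es expgzD /conjg !gnorm.
    by apply: (conjY _ _ t _ Yx d1 d2); [rewrite mulnS; lia | rewrite !inE eqxx].
  + have es : s = x'^-1 * z ^+z (- a)%R.
      by rewrite /x' invgM invgK expgzN invgK mulgK.
    exists (t - a)%R, ((x' ^ (z ^+z (t - a)%R))^-1 * v); split; first by rewrite mulnS; lia.
      rewrite es -conjVg GRing.addrC expgzD /conjg !gnorm.
      by [].
    by apply: (conjY _ _ (t - a)%R _ Yx d1 d2); [rewrite mulnS; lia | rewrite !inE eqxx orbT].
- exists t, v; split=> //; first by apply: leq_trans tA _; rewrite leq_mul2l mn orbT.
  apply: ball_mono vY; rewrite leq_mul //.
  by apply: leq_expl; rewrite ltnS leq_mul2l mn orbT.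
Qed.

End Collection.

(** * Coordinates along a chain and their distortion *)

Section ChainTheory.
Local Open Scope group_scope.
Local Open Scope classical_set_scope.
Variables (G : groupType) (H : nat -> set G) (z : nat -> G) (h : nat).
Hypothesis chn : central_chain setT H z h.
Implicit Types (x y g s u v : G) (i j n : nat).

Let sH i : subgroup (H i) := chain_subgroup chn i.

Lemma chain_top g : H 0 g.
Proof. by rewrite (chain0 chn). Qed.

Lemma chain_normal i : normal_subgroup (H i).
Proof.
split=> // x g Hx; rewrite (_ : x ^ g = x * [~ x, g]); last first.
  by rewrite commgEl mulVKg.
by apply: subgroupM => //; apply: (chain_le chn); apply: (chain_comm chn).
Qed.

Lemma chain_conj i x g : H i x -> H i (x ^ g).
Proof. by case: (chain_normal i) => _; apply. Qed.

Lemma chain_ge i j x : (i <= j)%N -> H j x -> H i x.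
Proof.
move=> /subnK <-; elim: (j - i)%N => // k IHk /(chain_le chn).
exact: IHk.
Qed.

Lemma chain_comml i x g : H i x -> H i.+1 [~ g, x].
Proof. by move=> Hx; rewrite -invgR; apply: subgroupV => //; apply: (chain_comm chn) Hx. Qed.

Lemma chain_icomm i x j s : H i s -> H (j + i) (icomm x j s).
Proof. by elim: j => // j IHj Hs; apply: (chain_comm chn); apply: IHj. Qed.

Lemma icomm_end i x j s : H i s -> (h <= j)%N -> icomm x j s = 1.
Proof.
move=> Hs le_hj; apply: (chain_end chn); apply: chain_ge (chain_icomm x j Hs).
by rewrite (leq_trans le_hj) // leq_addr.
Qed.

(** The exponent t is unique only modulo the order of z i in H i / H i.+1,
    hence a relation. *)
Definition coordinate i g (t : int) : Prop := H i.+1 (z i ^+z (- t)%R * g).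

Local Notation coord := coordinate.

Lemma coordE i (P : groupType) (f : ghom G P) :
  (forall g, f g = 1 <-> H i.+1 g) ->
  forall g t, coord i g t <-> f g = f (z i) ^+z t.
Proof.
move=> kerf g t; rewrite /coordinate -kerf gmulfM gmulfXz expgzN.
by split=> [/mulg1_eq|->]; rewrite ?invgK // mulVg.
Qed.

Lemma coord_exists i g : H i g -> exists t : int, coord i g t.
Proof. by move/(chain_cyclic chn). Qed.

Lemma coord_mem i g t : coord i g t -> H i g.
Proof.
move=> /(chain_le chn); apply: (proj1 (subgroupMl _ _ _)) => //.
by apply: subgroupXz => //; apply: (chain_gen chn).
Qed.

Lemma coordM i g g' a b : coord i g a -> coord i g' b -> coord i (g * g') (a + b)%R.
Proof.
have [P [f [_ kerf]]] := quotient_exists (chain_normal i.+1).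
by rewrite !(coordE kerf) gmulfM expgzD => -> ->.
Qed.

Lemma coordV i g a : coord i g a -> coord i g^-1 (- a)%R.
Proof.
have [P [f [_ kerf]]] := quotient_exists (chain_normal i.+1).
by rewrite !(coordE kerf) gmulfV expgzN => ->.
Qed.

Lemma coordXz i g a b : coord i g a -> coord i (g ^+z b) (a * b)%R.
Proof.
have [P [f [_ kerf]]] := quotient_exists (chain_normal i.+1).
by rewrite !(coordE kerf) gmulfXz expgzM => ->.
Qed.

Lemma coord0 i g : coord i g 0%R <-> H i.+1 g.
Proof. by rewrite /coordinate GRing.oppr0 mul1g. Qed.

Lemma coordJ i g t x : coord i g t -> coord i (g ^ x) t.
Proof.
move=> gt; rewrite (_ : g ^ x = g * [~ g, x]); last by rewrite commgEl mulVKg.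
rewrite -[t]GRing.addr0; apply: (coordM gt); apply/coord0.
by apply: (chain_comm chn); apply: coord_mem gt.
Qed.

Lemma coord_gen i a : coord i (z i ^+z a) a.
Proof. by rewrite /coordinate expgzN mulVg; apply: subgroup1. Qed.

Lemma coord_sub i g a b : coord i g a -> coord i g b -> H i.+1 (z i ^+z (a - b)%R).
Proof.
move=> ga gb; apply/coord0; rewrite -[0%R](GRing.subrr (a - b)%R).
rewrite [X in coord _ X]( _ : _ = z i ^+z (a - b)%R * (g * g^-1)^-1).
  apply: coordM (coord_gen i _) _.
  by apply: coordV; apply: coordM ga (coordV gb).
by rewrite mulgV invg1 mulg1.
Qed.

Lemma coord_ball i (X : set G) A n g :
  (forall x, X x -> exists2 t : int, (`|t| <= A)%N & coord i x t) ->
  ball X n g -> exists2 t : int, (`|t| <= A * n)%N & coord i g t.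
Proof.
move=> XA; move: n g; apply: ball_ind => [|n s g sX _ [t tA gt]|m n g mn [t tA gt]].
- by exists 0%R => //; apply/coord0; apply: subgroup1.
- have [a aA sa] : exists2 a : int, (`|a| <= A)%N & coord i s a.
    case: sX => /XA[a aA sa]; first by exists a.
    by exists (- a)%R; [rewrite abszN | move: (coordV sa); rewrite invgK].
  by exists (a + t)%R; [rewrite mulnS; lia | apply: coordM].
- by exists t => //; apply: leq_trans tA _; rewrite leq_mul2l mn orbT.
Qed.

Lemma order_modulo i : exists k : nat, forall t,
  H i.+1 (z i ^+z t) <-> exists q : int, t = (q * k%:Z)%R.
Proof.
apply: (@int_subgroup_principal (fun t => H i.+1 (z i ^+z t))).
- exact: subgroup1.
- by move=> a b Ha Hb; rewrite expgzD; apply: subgroupM.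
- by move=> a Ha; rewrite expgzN; apply: subgroupV.
Qed.

Lemma bounded_coords i (T : seq G) : (forall s, s \in T -> H i s) ->
  exists A, forall s, s \in T -> exists2 t : int, (`|t| <= A)%N & coord i s t.
Proof.
elim: T => [|s T IHT] HT; first by exists 0%N.
case: IHT => [u uT|A TA]; first by apply: HT; rewrite inE uT orbT.
have [t st] := coord_exists (HT s (mem_head _ _)).
exists (maxn `|t| A) => u; rewrite inE => /predU1P[->|/TA[b bA ub]].
  by exists t => //; rewrite leq_maxl.
by exists b => //; rewrite (leq_trans bA) ?leq_maxr.
Qed.

(** By collection, a word in elements of H i is z_i^t v, where v is a short
    word in elements of H i.+1. If the whole lies in H i.+1, then so does z_i^t,
    which is then a power of z_i^k with k the order of z_i modulo H i.+1. *)
Lemma chain_distortion (S : seq G) i : exists (T : seq G) (f : nat -> nat),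
  [/\ poly_bounded f, forall s, s \in T -> H i s
    & forall n g, H i g -> ball [set` S] n g -> ball [set` T] (f n) g].
Proof.
elim: i => [|i [T [f [pf HT ST]]]].
  by exists S, id; split=> // [|s _]; [apply: poly_id | apply: chain_top].
have [A TA] := bounded_coords HT.
have [c cP] : exists c : G -> int, forall s, s \in T ->
    (`|c s| <= A)%N /\ coord i s (c s).
  have : forall s, exists t : int, s \in T -> (`|t| <= A)%N /\ coord i s t.
    move=> s; have [/TA[t tA st]|] := boolP (s \in T); first by exists t.
    by exists 0%R.
  by move/choice => [c cP]; exists c.
pose r s := z i ^+z (- c s)%R * s.
have Hr s : s \in T -> H i.+1 (r s) by move=> /cP[].
have [k kP] := order_modulo i.
pose Y := [seq icomm (z i) j (r s) | s <- T, j <- iota 0 h.+1] ++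
  [seq icomm (z i)^-1 j (r s) | s <- T, j <- iota 0 h.+1] ++ [:: z i ^+ k].
pose F n := (f n * (A * f n).+1 ^ h + A * f n)%N.
have Yr s j : s \in T -> (icomm (z i) j (r s) \in Y) /\ (icomm (z i)^-1 j (r s) \in Y).
  move=> sT; have cap x : icomm x j (r s) = icomm x (minn j h) (r s).
    rewrite /minn; case: ltnP => // le_hj.
    by rewrite !(icomm_end _ (Hr s sT)).
  rewrite (cap (z i)) (cap (z i)^-1).
  split; rewrite !mem_cat; apply/orP; [left|right; apply/orP; left].
    by apply: allpairs_f => //; rewrite mem_iota add0n ltnS geq_minr.
  by apply: allpairs_f => //; rewrite mem_iota add0n ltnS geq_minr.
exists Y, F; split.
- apply: poly_add; last exact: poly_mul (poly_const A) pf.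
  apply: (poly_mul pf); apply: poly_exp.
  have := poly_add (poly_mul (poly_const A) pf) (poly_const 1).
  by apply: poly_le => n; rewrite addn1.
- have Hicomm x s j : s \in T -> H i.+1 (icomm x j (r s)).
    by move=> sT; apply: chain_ge (chain_icomm x j (Hr s sT)); rewrite leq_addl.
  move=> s; rewrite !mem_cat => /or3P[/allpairsP|/allpairsP|].
  + by move=> [[u j] [/= uT _ ->]]; apply: Hicomm.
  + by move=> [[u j] [/= uT _ ->]]; apply: Hicomm.
  + rewrite inE => /eqP->; apply/(kP (Posz k)); exists 1%R.
    by rewrite GRing.mul1r.
- move=> n g Hg /(ST n g (chain_le chn Hg)) gT.
  have [|t [v [tA eg vY]]] := @collect_power G [set` T] [set` Y] (z i) A h _ (f n) g gT.
    move=> s /= sT; exists (c s); have [cA cs] := cP s sT.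
    split; first exact: cA.
    - by move=> j; have [] := Yr s j sT.
    - exact: icomm_end (Hr s sT) (leqnn h).
    - exact: icomm_end (Hr s sT) (leqnn h).
  have Hv : H i.+1 v.
    apply: ball_sub vY => //= s; rewrite !mem_cat => /or3P[/allpairsP|/allpairsP|].
    + move=> [[u j] [/= uT _ ->]].
      by apply: chain_ge (chain_icomm _ j (Hr u uT)); rewrite leq_addl.
    + move=> [[u j] [/= uT _ ->]].
      by apply: chain_ge (chain_icomm _ j (Hr u uT)); rewrite leq_addl.
    + rewrite inE => /eqP->; apply/(kP (Posz k)); exists 1%R.
      by rewrite GRing.mul1r.
  have /kP[q eq_t] : H i.+1 (z i ^+z t).
    by move: Hg; rewrite eg; apply: (proj1 (subgroupMr _ _ _)).
  have Yk : ball [set` Y] 1 (z i ^+ k).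
    by apply: ball_gen => /=; rewrite !mem_cat inE eqxx !orbT.
  rewrite eg /F addnC; apply: ballM => //.
  have [k0|k0] := posnP k.
    by move: eq_t; rewrite k0 GRing.mulr0 => ->; apply: ball1.
  apply: (@ball_mono _ _ (`|q| * 1)); first by nia.
  rewrite eq_t GRing.mulrC expgzM; exact: ballXz.
Qed.

Lemma coord_distortion (S : seq G) i : exists2 f : nat -> nat, poly_bounded f &
  forall n g, H i g -> ball [set` S] n g ->
    exists2 t : int, (`|t| <= f n)%N & coord i g t.
Proof.
have [T [f [pf HT ST]]] := chain_distortion S i.
have [A TA] := bounded_coords HT.
exists (fun n => A * f n)%N; first exact: poly_mul (poly_const A) pf.
by move=> n g Hg gS; apply: coord_ball TA (ST n g Hg gS).
Qed.

End ChainTheory.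

(** * Finite quotients that are deep along the chain *)

Section DeepSubgroups.
Local Open Scope group_scope.
Local Open Scope classical_set_scope.
Variables (G : groupType) (H : nat -> set G) (z : nat -> G) (h : nat).
Hypothesis chn : central_chain setT H z h.
Implicit Types (x y g s u v w : G) (i j n q : nat) (L N : set G).

Let sH i : subgroup (H i) := chain_subgroup chn i.

(** That is, N meets H j inside <z_j^e> H_(j+1) for every j >= i. *)
Definition deep e i N :=
  forall j g, (i <= j)%N -> N g -> H j g ->
    exists k : int, coordinate H z j g (Posz e * k)%R.

(** If d = [u, g] commutes with u, then [u ^+ q, g] = d ^+ q. Modulo L this
    vanishes when d is in H i.+1. Each further power q therefore makes z_i
    commute with one more level of the chain, counted from the bottom. *)
Lemma power_central_modulo L i q : normal_subgroup L ->
  (forall g, H i.+1 g -> L (g ^+ q)) ->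
  forall j m g, H m g -> (h <= m + j)%N -> L [~ z i ^+ (q ^ j), g].
Proof.
move=> nL qL; have [P [f [_ kerf]]] := quotient_exists nL.
elim=> [|j IHj] m g Hg le_h.
  have -> : g = 1.
    by apply: (chain_end chn); apply: (chain_ge chn) Hg; rewrite -[m]addn0.
  by rewrite commg1; apply: subgroup1; case: nL.
rewrite expnSr expgnA; set u := z i ^+ (q ^ j).
have Hu : H i u.
  by apply: (@subgroupXz _ _ _ (Posz (q ^ j))) => //; apply: (chain_gen chn).
pose d := [~ u, g].
have dq : f d ^+ q = 1.
  by rewrite -gmulfXn; apply/kerf/qL; apply: (chain_comm chn).
have du : commute (f u) (f d).
  apply/commgP; rewrite -gmulfR; apply/eqP/kerf; apply: (IHj m.+1).
    exact: (chain_comml chn).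
  by rewrite addSnnS.
apply/kerf; rewrite gmulfR gmulfXn /commg conjXg.
have -> : f u ^ f g = f u * f d by rewrite gmulfR commgEl mulVKg.
by rewrite expgMn // dq mulg1 mulVg.
Qed.

(** The new subgroup is <u> L, which is normal because u is central modulo L.
    It is used with u = 1 if z_i has finite order B modulo H i.+1, and with
    u = z_i ^+ B otherwise; in both cases <u> meets H i.+1 trivially, so
    <u> L has the same trace as L on H i.+1. *)
Lemma deep_extension e i L (T : seq G) q u (c : int) B w :
  normal_subgroup L -> L `<=` H i.+1 -> deep e i.+1 L ->
  (forall g, H i.+1 g -> exists2 t, t \in T & L (t^-1 * g)) ->
  (forall g, H i.+1 g -> L (g ^+ q)) ->
  (forall g, L [~ u, g]) -> u = z i ^+z (Posz e * c)%R ->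
  (forall s : int, H i.+1 (u ^+z s) -> u ^+z s = 1) ->
  (0 < B)%N -> z i ^+ B = u * w -> H i.+1 w ->
  exists (L1 : set G) (T1 : seq G),
  [/\ normal_subgroup L1 /\ L1 `<=` H i, deep e i L1,
      forall g, H i g -> exists2 t, t \in T1 & L1 (t^-1 * g),
      forall g, H i g -> L1 (g ^+ (B * q)) & (size T1 <= B * size T)%N].
Proof.
move=> nL LH dL TL qL uL eu u1 B0 eB Hw.
have [P [f [_ kerf]]] := quotient_exists nL.
have uC x : commute (f u) (f x).
  by apply/commgP; rewrite -gmulfR; apply/eqP/kerf; apply: uL.
have uwX (a : int) : f (z i ^+z (Posz B * a)%R) = f u ^+z a * f (w ^+z a).
  by rewrite expgzM /= eB !gmulfXz gmulfM expgzMn //; apply: uC.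
pose L1 := [set g | exists s : int, f g = f u ^+z s].
have L1E g (s : int) : f g = f u ^+z s -> L (u ^+z (- s)%R * g).
  by move=> fg; apply/kerf; rewrite gmulfM gmulfXz fg -expgzD GRing.addNr.
have Hu : H i u by rewrite eu; apply: subgroupXz => //; apply: (chain_gen chn).
exists L1, [seq z i ^+ a * t | a <- iota 0 B, t <- T]; split.
- split; last first.
    move=> g [s /L1E/LH/(chain_le chn)]; apply: (proj1 (subgroupMl _ _ _)) => //.
    exact: subgroupXz.
  split.
    apply/subgroupP; split=> [|x y [s fx] [t fy]|x [s fx]].
    + by exists 0%R; rewrite gmulf1.
    + by exists (s + t)%R; rewrite gmulfM fx fy expgzD.
    + by exists (- s)%R; rewrite gmulfV fx expgzN.
  move=> x g [s fx]; exists s; rewrite gmulfJ fx conjXz.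
  by congr (_ ^+z _); apply/conjg_fixP; apply/eqP; apply/eqP/commgP; apply: uC.
- move=> j g; rewrite leq_eqVlt => /predU1P[<-|lt_ij] [s fg] Hg.
    exists (c * s)%R; rewrite -(mulKg (u ^+z (- s)%R) g) -expgzN GRing.opprK.
    rewrite GRing.mulrA -[(_ * _ * _)%R]GRing.addr0; apply: (coordM chn).
      by rewrite eu -expgzM; apply: (coord_gen chn).
    by apply/coord0; apply: LH; apply: L1E.
  have Hus : H i.+1 (u ^+z s).
    have := sH i.+1; move/subgroupV => /(_ _ (LH _ (L1E g s fg))).
    rewrite expgzN invgM invgK; apply: (proj1 (subgroupMl _ _ _)) => //.
    by apply: subgroupV => //; apply: (chain_ge chn) Hg.
  by apply: dL => //; have := L1E g s fg; rewrite expgzN (u1 s Hus) invg1 mul1g.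
- move=> g /(coord_exists chn)[a ga]; set b := (a %/ B)%Z.
  have [v ev Hv] : exists2 v, g = z i ^+z a * v & H i.+1 v.
    by exists (z i ^+z (- a)%R * g) => //; rewrite expgzN mulVKg.
  have [|t tT Lt] := TL (w ^+z b * v).
    by apply: subgroupM => //; apply: subgroupXz.
  have B0Z : (Posz B != 0)%R by rewrite eqz_nat -lt0n.
  exists (z i ^+ `|(a %% B)%Z| * t).
    apply: allpairs_f => //; rewrite mem_iota leq0n add0n.
    by rewrite -ltz_nat gez0_abs ?modz_ge0 ?ltz_pmod.
  exists b; have -> : g = z i ^+ `|(a %% B)%Z| * z i ^+z (Posz B * b)%R * v.
    rewrite -[z i ^+ _]/(z i ^+z Posz _) gez0_abs ?modz_ge0 // -expgzD.
    by rewrite GRing.mulrC GRing.addrC -divz_eq.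
  have {}Lt : f (w ^+z b) * f v = f t.
    move/kerf: Lt; rewrite gmulfM gmulfV => /mulg1_eq.
    by rewrite invgK gmulfM => <-.
  rewrite gmulfM gmulfV !gmulfM uwX -!mulgA Lt invgM -!mulgA mulKg.
  by have := commuteXz b (commute_sym (uC t)) => <-; rewrite mulKg.
- move=> g /(coord_exists chn)[a ga]; exists (a * Posz q)%R.
  have gB : H i.+1 (z i ^+z (- (a * Posz B))%R * g ^+ B).
    by have := coordXz chn (Posz B) ga.
  have [v eg Hv] : exists2 v, g ^+ B = z i ^+z (Posz B * a)%R * v & H i.+1 v.
    by eexists; last exact: gB; rewrite GRing.mulrC expgzN mulVKg.
  have wv : f (w ^+z a) * f v = f (w ^+z a * v) by rewrite gmulfM.
  rewrite expgnA eg gmulfXn gmulfM uwX -mulgA wv expgMn; last first.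
    by apply: commute_sym; apply: commuteXz; apply: commute_sym.
  rewrite -[X in _ * X]gmulfXn (_ : f ((w ^+z a * v) ^+ q) = 1) ?mulg1 ?expgzM //.
  by apply/kerf; apply: qL; apply: subgroupM => //; apply: subgroupXz.
- by rewrite size_allpairs size_iota.
Qed.

(** Going up one level multiplies the number of cosets and the exponent of the
    quotient by at most k + e q ^ h, where q is the exponent so far and k, the
    order of z_i modulo H i.+1, depends on the chain only. With h levels the
    bound stays polynomial in e. *)
Lemma deep_subgroup i : (i <= h)%N -> exists2 b : nat -> nat, poly_bounded b &
  forall e, (0 < e)%N -> exists L (T : seq G) q,
  [/\ normal_subgroup L /\ L `<=` H i, deep e i L,
      forall g, H i g -> exists2 t, t \in T & L (t^-1 * g),
      forall g, H i g -> L (g ^+ q) &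
      (size T <= b e)%N && (q <= b e)%N && (0 < q)%N].
Proof.
move=> le_ih; rewrite -(subKn le_ih); elim: (h - i)%N (leq_subr i h) => [_|d IHd lt_dh].
  exists (fun=> 1%N); first exact: poly_const.
  move=> e e0; exists [set 1], [:: 1], 1%N; rewrite subn0.
  have H1 x : H h x -> x = 1 by apply: (chain_end chn).
  split=> //.
  - split; last by move=> _ ->; apply: subgroup1.
    split; last by move=> _ g ->; rewrite conj1g.
    by apply/subgroupP; split=> [|x y -> ->|x ->] //; rewrite /set1/mkset ?mulg1 ?invg1.
  - move=> j g _ -> _; exists 0%R; rewrite GRing.mulr0.
    by apply/coord0; apply: subgroup1.
  - by move=> g /H1->; exists 1; rewrite ?inE // invg1 mulg1.
have [b pb bP] := IHd (ltnW lt_dh).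
have ei : (h - d = (h - d.+1).+1)%N by lia.
move: bP; rewrite ei; set i' := (h - d.+1)%N => bP {IHd i le_ih}; rename i' into i.
have [k kP] := order_modulo chn i.
exists (fun e => (b e ^ h * e + k).+1 * b e)%N.
  apply: poly_mul => //; apply: (@poly_le _ (fun e => b e ^ h * e + k + 1)%N).
    by move=> e; rewrite addn1.
  apply: poly_add (poly_const 1); apply: poly_add (poly_const k).
  exact: poly_mul (poly_exp h pb) poly_id.
move=> e e0; have [L [T [q [[nL LH] dL TL qL /andP[/andP[Tb qb] q0]]]]] := bP e e0.
have ext u (c : int) B w : (forall g, L [~ u, g]) -> u = z i ^+z (Posz e * c)%R ->
    (forall s : int, H i.+1 (u ^+z s) -> u ^+z s = 1) -> (0 < B)%N ->
    (B <= (b e ^ h * e + k).+1)%N -> z i ^+ B = u * w -> H i.+1 w ->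
    exists L (T : seq G) q,
    [/\ normal_subgroup L /\ L `<=` H i, deep e i L,
      forall g, H i g -> exists2 t, t \in T & L (t^-1 * g),
      forall g, H i g -> L (g ^+ q) &
      (size T <= (b e ^ h * e + k).+1 * b e)%N && (q <= (b e ^ h * e + k).+1 * b e)%N && (0 < q)%N].
  move=> uL eu u1 B0 leB eB Hw.
  have [L1 [T1 [L1n L1d L1T L1q sT1]]] :=
    deep_extension nL LH dL TL qL uL eu u1 B0 eB Hw.
  exists L1, T1, (B * q)%N; split=> //; rewrite muln_gt0 B0 q0 !andbT.
  by rewrite (leq_trans sT1) leq_mul.
have [k0|k0] := posnP k; last first.
  apply: (ext 1 0%R k (z i ^+ k)) => //.
  - by move=> g; rewrite comm1g; apply: subgroup1; case: nL.
  - by rewrite GRing.mulr0.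
  - by move=> s _; rewrite (_ : 1 ^+z s = 1) //; case: s => n; rewrite /= expg1n ?invg1.
  - by rewrite leqW // leq_addl.
  - by rewrite mul1g.
  - by apply/(kP (Posz k)); exists 1%R; rewrite GRing.mul1r.
apply: (ext (z i ^+ (q ^ h * e)) (Posz (q ^ h)) (q ^ h * e)%N 1) => //.
- move=> g; have [P [f [_ kerf]]] := quotient_exists nL.
  apply/kerf; rewrite gmulfR; apply/eqP/commgP; rewrite expgnA gmulfXn.
  apply/commute_sym/commuteX/commute_sym/commgP; rewrite -gmulfR; apply/eqP/kerf.
  exact: (power_central_modulo nL qL (chain_top chn g)).
- by rewrite -PoszM mulnC.
- move=> s; rewrite -[z i ^+ _]/(z i ^+z Posz _) -expgzM => /kP[r].
  by rewrite k0 GRing.mulr0 => ->.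
- by rewrite muln_gt0 expn_gt0 q0 e0.
- by rewrite leqW // (leq_trans _ (leq_addr _ _)) // leq_mul2r leq_expl ?orbT.
- by rewrite mulg1.
- exact: subgroup1.
Qed.

Theorem deep_finite_quotient : exists2 b : nat -> nat, poly_bounded b &
  forall e, (0 < e)%N -> exists (Q : finGroupType) (f : ghom G Q),
    (#|Q| <= b e)%N /\ deep e 0 [set g | f g = 1].
Proof.
have [b pb bP] := deep_subgroup (leq0n h); exists b => // e e0.
have [L [T [q [[nL _] dL TL _ /andP[/andP[Tb _] _]]]]] := bP e e0.
have [|Q [f [Qb kerf]]] := finite_quotient nL (T := T).
  by move=> g; apply: TL; apply: (chain_top chn).
exists Q, f; split; first exact: leq_trans Tb.
by move=> j g j0 /kerf; apply: dL.
Qed.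

End DeepSubgroups.

(** * Short generators for centralizers along the chain *)

Section Centralizers.
Local Open Scope group_scope.
Local Open Scope classical_set_scope.
Variables (G : groupType) (H : nat -> set G) (z : nat -> G) (h : nat).
Hypothesis chn : central_chain setT H z h.
Implicit Types (x y g s u v w c d : G) (i j n q N : nat) (t a b : int).

Let sH i : subgroup (H i) := chain_subgroup chn i.
Local Notation coord := (coordinate H z).

Definition cen x i : set G := [set g | H i [~ x, g]].

(** The exponents of z_i in the image of the homomorphism c |-> [~ x, c] from
    cen x i to H i / H i.+1. *)
Definition jump x i t := exists c, coord i [~ x, c] t.

Lemma cen_top x g : cen x 0 g.
Proof. exact: (chain_top chn). Qed.

Lemma cen_le x i g : cen x i.+1 g -> cen x i g.
Proof. exact: (chain_le chn). Qed.

Lemma cen_subgroup x i : subgroup (cen x i).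
Proof.
have [P [f [_ kerf]]] := quotient_exists (chain_normal chn i).
have cE g : cen x i g <-> commute (f x) (f g).
  rewrite /cen /mkset -kerf gmulfR; split=> [/eqP/commgP //|xg].
  exact/eqP/commgP.
apply/subgroupP; split=> [|g g'|g]; rewrite !cE.
- by rewrite gmulf1; apply: commute1.
- by rewrite gmulfM; apply: commuteM.
- by rewrite gmulfV; apply: commuteV.
Qed.

Lemma shift_cen x i c t : coord i [~ x, c] t -> cen x i c.
Proof. exact: (coord_mem chn). Qed.

Lemma shift0 x i c : coord i [~ x, c] 0%R <-> cen x i.+1 c.
Proof. exact: coord0. Qed.

Lemma shift_exists x i c : cen x i c -> exists t, coord i [~ x, c] t.
Proof. exact: (coord_exists chn). Qed.

(** [~ x, c * d] = [~ x, d] * [~ x, c] ^ d, and conjugation does not change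
    coordinates. *)
Lemma shiftM x i c d a b : coord i [~ x, c] a -> coord i [~ x, d] b ->
  coord i [~ x, c * d] (a + b)%R.
Proof.
move=> ca db; rewrite (_ : [~ x, c * d] = [~ x, d] * [~ x, c] ^ d).
  by rewrite GRing.addrC; apply: (coordM chn) => //; apply: (coordJ chn).
by rewrite /commg /conjg !gnorm.
Qed.

Lemma shiftV x i c a : coord i [~ x, c] a -> coord i [~ x, c^-1] (- a)%R.
Proof.
move=> ca; rewrite (_ : [~ x, c^-1] = ([~ x, c]^-1) ^ c^-1).
  by apply: (coordJ chn); apply: (coordV chn).
by rewrite /commg /conjg !gnorm.
Qed.

Lemma shift1 x i : coord i [~ x, 1] 0%R.
Proof. by apply/shift0; apply: subgroup1; apply: cen_subgroup. Qed.

Lemma shiftXz x i c a b : coord i [~ x, c] a -> coord i [~ x, c ^+z b] (a * b)%R.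
Proof.
move=> ca; have caX n : coord i [~ x, c ^+ n] (a * Posz n)%R.
  elim: n => [|n IHn]; first by rewrite GRing.mulr0; apply: shift1.
  by rewrite expgS intS GRing.mulrDr GRing.mulr1; apply: shiftM.
case: b => n; first exact: caX.
by rewrite NegzE GRing.mulrN; apply: shiftV.
Qed.

Lemma cen_conj x i c d : cen x i.+1 c -> cen x i d -> cen x i.+1 (c ^ d).
Proof.
move=> /shift0 xc /shift_exists[b xd]; apply/shift0.
rewrite -(GRing.addNr b) -[X in (_ + X)%R](GRing.add0r b).
by apply: shiftM; [apply: shiftV | apply: shiftM].
Qed.

Lemma coord_change i g a b : coord i g a -> H i.+1 (z i ^+z (a - b)%R) -> coord i g b.
Proof.
move=> ga Hab; rewrite /coordinate (_ : (- b = (a - b) - a)%R); last first.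
  by rewrite GRing.addrC GRing.addKr.
by rewrite expgzD -mulgA; apply: subgroupM.
Qed.

Lemma jump_modulus x i t : H i.+1 (z i ^+z t) -> jump x i t.
Proof.
move=> Ht; exists 1; apply: coord_change (shift1 x i) _.
by rewrite GRing.sub0r expgzN; apply: subgroupV.
Qed.

Lemma jump_principal x i : exists m : nat,
  forall t, jump x i t <-> exists q : int, t = (q * Posz m)%R.
Proof.
apply: (@int_subgroup_principal (jump x i)).
- by exists 1; apply: shift1.
- by move=> a b [c ca] [d db]; exists (c * d); apply: shiftM.
- by move=> a [c ca]; exists c^-1; apply: shiftV.
Qed.

Variable S : seq G.
Local Notation Sball := (ball [set` S]).

Definition cen_generated i K := forall n x, Sball n x -> forall g,
  cen x i g -> generated (cen x i `&` Sball (pbound K n)) g.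

(** The coordinate of a product is the sum of those of its factors, and the
    factors are short; the order of z_i modulo H i.+1 is allowed as a summand
    to account for the ambiguity of coordinates. *)
Lemma jump_as_sum i K : cen_generated i K ->
  exists2 A : nat -> nat, poly_bounded A & forall n x t, Sball n x -> jump x i t ->
  exists2 l : seq int, t = (\sum_(a <- l) a)%R &
    {in l, forall a, (`|a| <= A n)%N /\
                     exists2 c, Sball (pbound K n) c & coord i [~ x, c] a}.
Proof.
move=> genK; have [k kP] := order_modulo chn i.
have [p pp pP] := coord_distortion chn S i.
exists (fun n => p (n.*2 + (pbound K n).*2) + k)%N.
  apply: poly_add (poly_const k); apply: (poly_comp pp).
  by apply: poly_add; apply: poly_double; [apply: poly_id | apply: poly_pbound].
move=> n x t xS [g gt]; set A := (_ + k)%N.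
pose T a := (`|a| <= A)%N /\ exists2 c, Sball (pbound K n) c & coord i [~ x, c] a.
have letterT s : letter (cen x i `&` Sball (pbound K n)) s ->
    exists2 a, T a & coord i [~ x, s] a.
  move=> sX; have [xs sS] : cen x i s /\ Sball (pbound K n) s.
    case: sX => -[] // xs /ballV sS; split; last by rewrite -[s]invgK.
    by rewrite -[s]invgK; apply: subgroupV => //; apply: cen_subgroup.
  have [a aA xa] := pP _ _ xs (ballR xS sS).
  by exists a => //; split; [rewrite (leq_trans aA) // leq_addr | exists s].
have [l lT xl] : exists2 l : seq int, {in l, forall a, T a} &
    coord i [~ x, g] (\sum_(a <- l) a)%R.
  have [N] := genK n x xS g (shift_cen gt).
  move: N g {gt}; apply: ball_ind => [|N s g sX _ [l lT xl]|//].
    by exists [::] => //; rewrite big_nil; apply: shift1.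
  have [a Ta xa] := letterT s sX; exists (a :: l); last first.
    by rewrite big_cons; apply: shiftM.
  by move=> b; rewrite inE => /predU1P[->|/lT].
have /kP[q eq_q] := coord_sub chn gt xl.
have Tk b : `|b|%N = k -> T b.
  move=> eb; split; first by rewrite eb leq_addl.
  exists 1; first exact: ball1.
  apply: coord_change (shift1 x i) _; rewrite GRing.sub0r; apply/kP.
  have [->|->] : b = Posz k \/ b = (- Posz k)%R by lia.
    by exists (-1)%R; lia.
  by exists 1%R; lia.
exists (l ++ nseq `|q| (if (0 <= q)%R then Posz k else - Posz k)%R).
  rewrite big_cat /= big_nseq GRing.iter_addr_0 -GRing.mulr_natr.
  rewrite -[t](GRing.subrK (\sum_(a <- l) a)%R) eq_q GRing.addrC.
  by congr (_ + _)%R; case: ifP; lia.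
move=> b; rewrite mem_cat => /orP[/lT //|].
by rewrite mem_nseq => /andP[_ /eqP->]; apply: Tk; case: ifP => _; lia.
Qed.

Lemma short_jump i K : cen_generated i K -> exists K', forall n x t,
  Sball n x -> jump x i t ->
  exists2 c, Sball (pbound K' (n + `|t|)) c & coord i [~ x, c] t.
Proof.
move=> genK; have [A [L AL] AP] := jump_as_sum genK.
pose B N := ((N + pbound L N * pbound L N + pbound L N) * pbound K N)%N.
have [K' BK'] : poly_bounded B.
  apply: poly_mul (poly_pbound K); apply: poly_add (poly_pbound L).
  by apply: poly_add poly_id _; apply: poly_mul; apply: poly_pbound.
exists K' => n x t xS xt; have [l et lT] := AP n x t xS xt.
pose T a := (`|a| <= A n)%N /\ exists2 c, Sball (pbound K n) c & coord i [~ x, c] a.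
have [|a [aA [c cS xc]]|l' [l'T el' sl']] := @short_sum (A n) T l _ _ lT.
- by move=> a [].
- split; first by rewrite abszN.
  by exists c^-1; [apply: ballV | apply: shiftV].
have [c cS xc] : exists2 c, Sball (size l' * pbound K n) c &
    coord i [~ x, c] (\sum_(a <- l') a)%R.
  elim: l' l'T {el' sl'} => [|a l' IHl] l'T.
    by exists 1; [apply: ball1 | rewrite big_nil; apply: shift1].
  have [c cS xc] := IHl (fun b bl => l'T b (@mem_behead _ (a :: l') b bl)).
  have [_ [d dS xd]] := l'T a (mem_head _ _).
  by exists (d * c); [rewrite /= mulSn; apply: ballM | rewrite big_cons; apply: shiftM].
exists c; last by rewrite et -el'.
apply: ball_mono cS; apply: leq_trans (BK' _); rewrite /B.
apply: leq_mul; last by apply: pbound_mono; rewrite leq_addr.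
apply: leq_trans sl' _; rewrite -et.
have AL' : (A n <= pbound L (n + `|t|))%N.
  by apply: leq_trans (AL n) _; apply: pbound_mono; rewrite leq_addr.
by rewrite leq_add // leq_add ?leq_mul // leq_addl.
Qed.

(** If m > 0, one of the bounded summands of m is nonzero, and m divides it. *)
Lemma jump_generator_bound i K : cen_generated i K -> exists L, forall n x,
  Sball n x -> exists2 m, (m <= pbound L n)%N &
    forall t, jump x i t <-> exists q : int, t = (q * Posz m)%R.
Proof.
move=> genK; have [A [L AL] AP] := jump_as_sum genK.
exists L => n x xS; have [m mP] := jump_principal x i.
exists m => //; apply: leq_trans (AL n).
have [->//|m0] := posnP m.
have xm : jump x i (Posz m) by apply/mP; exists 1%R; rewrite GRing.mul1r.
have [l em lT] := AP n x _ xS xm.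
have [[a al a0]|l0] := pselect (exists2 a, a \in l & a != 0%R).
  have [aA [c _ xc]] := lT a al; apply: leq_trans aA.
  have /mP[q eq_a] : jump x i a by exists c.
  rewrite eq_a abszM leq_pmull // absz_gt0.
  by apply: contraNneq a0 => q0; rewrite eq_a q0 GRing.mul0r.
move: em; rewrite big_seq big1 => [|a al]; first by case: m m0 {mP xm}.
by have [//|a0] := eqVneq a 0%R; case: l0; exists a.
Qed.

Lemma icomm_ball w (a b : nat) j s : Sball a s -> Sball b w ->
  Sball (2 ^ j * (a + b.*2)) (icomm w j s).
Proof.
move=> sS wS; suff : Sball (2 ^ j * (a + b.*2) - b.*2) (icomm w j s).
  by apply: ball_mono; rewrite leq_subr.
elim: j => [|j IHj]; first by rewrite expn0 mul1n addnK.
apply: ball_mono (ballR IHj wS); rewrite expnS.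
have : (0 < 2 ^ j)%N by rewrite expn_gt0.
by nia.
Qed.

(** Let c0 be a short element whose coordinate is the generator m of jump x i.
    Each short generator c of cen x i is c0 ^+z a * d with d in cen x i.+1.
    Collecting the powers of c0 in a word for an element of cen x i.+1 leaves
    iterated commutators of the elements d with c0, which are short elements of
    cen x i.+1, and a power of c0 in cen x i.+1, which is a power of c0 ^+ r
    where r * m is the order of z_i modulo H i.+1. *)
Lemma cen_generatedS i K : cen_generated i K -> exists K', cen_generated i.+1 K'.
Proof.
move=> genK; have [k kP] := order_modulo chn i.
have [L mL] := jump_generator_bound genK; have [M shortM] := short_jump genK.
have [p pp pP] := coord_distortion chn S i.
pose A n := p (n.*2 + (pbound K n).*2)%N.
pose b n := pbound M (n + pbound L n).
pose W n := (2 ^ h * ((A n * b n + pbound K n) + (b n).*2) + k * b n + pbound K n)%N.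
have pb : poly_bounded b.
  exact: poly_comp (poly_pbound M) (poly_add poly_id (poly_pbound L)).
have pA : poly_bounded A.
  by apply: (poly_comp pp); apply: poly_add; apply: poly_double;
    [apply: poly_id | apply: poly_pbound].
have [K' WK'] : poly_bounded W.
  apply: poly_add (poly_pbound K); apply: poly_add; last exact: poly_mul (poly_const k) pb.
  apply: poly_mul (poly_const _) _; apply: poly_add; last exact: poly_double.
  by apply: poly_add (poly_pbound K); apply: poly_mul.
exists K' => n x xS g xg.
have [m mLn mP] := mL n x xS.
pose X := cen x i `&` Sball (pbound K n); pose Y := cen x i.+1 `&` Sball (W n).
suff : generated Y g.
  move=> [N gY]; exists N; apply: ball_subset gY => y [xy yS]; split=> //.
  exact: ball_mono (WK' n) yS.
have [N gX] := genK n x xS g (cen_le xg).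
have [m0|m0] := posnP m.
  exists N; apply: ball_subset gX => y [xy yS]; split; last first.
    by apply: ball_mono yS; rewrite leq_addl.
  have [t xt] := shift_exists xy; apply/shift0.
  have /mP[q et] : jump x i t by exists y.
  by move: xt; rewrite et m0 GRing.mulr0.
have xm : jump x i (Posz m) by apply/mP; exists 1%R; rewrite GRing.mul1r.
have [c0 c0S xc0] := shortM n x _ xS xm.
have {}c0S : Sball (b n) c0 by apply: ball_mono c0S; apply: pbound_mono; rewrite leq_add2l.
have c0C := shift_cen xc0.
have icommY d j w : Sball (A n * b n + pbound K n) d -> cen x i.+1 d ->
    Sball (b n) w -> cen x i w -> Y (icomm w j d).
  move=> dS xd wS xw; split.
    elim: j => //= j IHj; have sC := cen_subgroup x i.+1.
    by apply: subgroupM => //; [apply: subgroupV | apply: cen_conj].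
  have [le_hj|lt_jh] := leqP h j.
    rewrite (icomm_end chn _ (chain_top chn d) le_hj); exact: ball1.
  apply: ball_mono (icomm_ball j dS wS); rewrite /W -[leqRHS]addnA.
  apply: leq_trans (leq_addr _ _); rewrite leq_mul2r leq_pexp2l ?orbT //.
  exact: ltnW.
have collectX c : X c -> exists a : int, let c' := c0 ^+z (- a)%R * c in
    [/\ (`|a| <= A n)%N, forall j, Y (icomm c0 j c') /\ Y (icomm c0^-1 j c'),
      icomm c0 h c' = 1 & icomm c0^-1 h c' = 1].
  move=> [xc cS]; have [t tA xt] := pP _ _ xc (ballR xS cS).
  have /mP[a ea] : jump x i t by exists c.
  have aA : (`|a| <= A n)%N by apply: leq_trans tA; rewrite ea; nia.
  exists a => c'; have dS : Sball (A n * b n + pbound K n) c'.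
    apply: ballM => //; apply: (@ball_mono _ _ (`|(- a)%R| * b n)).
      by rewrite abszN leq_mul2r aA orbT.
    exact: ballXz.
  have xd : cen x i.+1 c'.
    apply/shift0; have <- : (Posz m * - a + t)%R = 0%R by rewrite ea; lia.
    by apply: shiftM => //; apply: shiftXz.
  split=> // [j||]; [|exact: (icomm_end chn _ (chain_top chn _) (leqnn h))..].
  split; apply: icommY => //; first exact: ballV.
  by apply: subgroupV => //; apply: cen_subgroup.
have [t [v [_ eg vY]]] := collect_power collectX gX.
have xv : cen x i.+1 v by apply: ball_sub vY => //; [apply: cen_subgroup | move=> y []].
have xt : cen x i.+1 (c0 ^+z t).
  move: xg; rewrite eg; apply: (proj1 (subgroupMr _ _ _)) => //.
  exact: cen_subgroup.
have [r er] : exists r : nat, k = (r * m)%N.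
  have /mP[r er] : jump x i (Posz k).
    by apply/jump_modulus/kP; exists 1%R; rewrite GRing.mul1r.
  by exists `|r|%N; nia.
have [q eq] : exists q : int, t = (q * Posz r)%R.
  have xt' := shiftXz t xc0.
  have [q eq] : exists q : int, (Posz m * t - 0 = q * Posz k)%R.
    by apply/kP; apply: (coord_sub chn) xt' _; apply/shift0.
  exists q; apply: (@GRing.mulfI _ (Posz m)); first by rewrite eqz_nat -lt0n.
  by move: eq; rewrite er; lia.
have Yr : Y (c0 ^+z Posz r).
  split.
    apply/shift0; apply: coord_change (shiftXz (Posz r) xc0) _.
    by apply/kP; exists 1%R; rewrite er; lia.
  apply: (@ball_mono _ _ (`|Posz r| * b n)); last exact: ballXz.
  rewrite /W -addnA; apply: leq_trans (leq_addl _ _); apply: leq_trans (leq_addr _ _).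
  by rewrite leq_mul2r er; nia.
rewrite eg; apply: subgroupM (generated_is_subgroup _) _ _; last by eexists; apply: vY.
rewrite eq GRing.mulrC expgzM; apply: subgroupXz; first exact: generated_is_subgroup.
exact: generated_gen.
Qed.

Lemma cen_generated_exists (genS : generating S) i : exists K, cen_generated i K.
Proof.
elim: i => [|i [K]]; last exact: cen_generatedS.
exists 1%N => n x _ g _; have [N gS] := generating_ball genS g.
exists N; apply: ball_subset gS => s sS; split; first exact: cen_top.
apply: (@ball_mono _ _ 1); last exact: ball_gen.
by rewrite /pbound expn1 addn1.
Qed.

End Centralizers.

(** * Separating conjugacy classes along the chain *)

Section Separation.
Local Open Scope group_scope.
Local Open Scope classical_set_scope.
Variables (G : groupType) (H : nat -> set G) (z : nat -> G) (h : nat).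
Hypothesis chn : central_chain setT H z h.
Variable S : seq G.
Hypothesis genS : generating S.
Implicit Types (x y g s u v w c d r : G) (i j n q N : nat) (t a b : int).

Let sH i : subgroup (H i) := chain_subgroup chn i.
Local Notation coord := (coordinate H z).
Local Notation cen := (cen H).
Local Notation jump := (jump H z).
Local Notation Sball := (ball [set` S]).

Definition conj_below x y i := exists g, H i (x^-1 * y ^ g).

Lemma conj_below_shift x y i g c t :
  coord i (x^-1 * y ^ g) t -> coord i [~ x, c] (- t)%R ->
  H i.+1 (x^-1 * y ^ (g * c)).
Proof.
move=> gt ct; apply/(coord0 H z).
rewrite (_ : _ * _ = [~ x, c] * (x^-1 * y ^ g) ^ c).
  rewrite -(GRing.addNr t); apply: (coordM chn) => //; exact: (coordJ chn).
by rewrite /commg /conjg !gnorm.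
Qed.

Lemma conj_below_jump x y i g g' t : coord i (x^-1 * y ^ g) t ->
  H i.+1 (x^-1 * y ^ g') -> jump x i (- t)%R.
Proof.
move=> gt /(coord0 H z) g'0; exists (g^-1 * g').
rewrite (_ : [~ x, g^-1 * g'] = (x^-1 * y ^ g') * ((x^-1 * y ^ g) ^ (g^-1 * g'))^-1).
  rewrite -[(- t)%R](GRing.add0r); apply: (coordM chn) => //.
  by apply: (coordV chn); apply: (coordJ chn).
by rewrite /commg /conjg !gnorm.
Qed.

(** If g makes x and y agree modulo H i, the remaining discrepancy z_i^t has t
    of polynomial size. When it can be removed at all, a short element of
    cen x i removes it. *)
Lemma short_conjugator i : exists K, forall n x y, Sball n x -> Sball n y ->
  conj_below x y i -> exists2 g, Sball (pbound K n) g & H i (x^-1 * y ^ g).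
Proof.
elim: i => [|i [K IHK]].
  exists 0%N => n x y _ _ _; exists 1; first exact: ball1.
  exact: (chain_top chn).
have [L genL] := cen_generated_exists chn genS i.
have [M shortM] := short_jump chn genL.
have [p pp pP] := coord_distortion chn S i.
pose A n := p (n + (n + (pbound K n).*2))%N.
have pA : poly_bounded A.
  apply: (poly_comp pp); apply: poly_add poly_id _; apply: poly_add poly_id _.
  exact/poly_double/poly_pbound.
have [K' K'P] : poly_bounded (fun n => pbound K n + pbound M (n + A n))%N.
  apply: poly_add (poly_pbound K) _; apply: (poly_comp (poly_pbound M)).
  exact: poly_add poly_id pA.
exists K' => n x y xS yS [g' Hg'].
have [|g gS Hg] := IHK n x y xS yS; first by exists g'; apply: (chain_le chn).
have [t tA gt] := pP _ _ Hg (ballM (ballV xS) (ballJ yS gS)).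
have [c cS ct] := shortM n x _ xS (conj_below_jump gt Hg').
exists (g * c); last exact: conj_below_shift gt ct.
apply: ball_mono (K'P n) _; apply: ballM gS _; apply: ball_mono cS.
by apply: pbound_mono; rewrite leq_add2l abszN.
Qed.

(** Seen through f, the centralizer of f' x modulo f' (H i) is no larger than
    the image of cen x i. *)
Definition controls_centralizer x i (Q Q' : finGroupType)
    (f : ghom G Q) (f' : ghom G Q') :=
  (forall g, f' g = 1 -> f g = 1) /\
  forall g v, f' v = 1 -> H i (v * [~ x, g]) ->
    exists c u, [/\ cen x i c, f u = 1 & g = c * u].

(** The step from i to i.+1 applies the induction hypothesis to a quotient
    that is deep enough at level i. It writes g as c * u with c in cen x i and
    u in the kernel and, if m > 0, it forces the coordinate of [~ x, c] to be a
    multiple of m * #|Q|. A power of c0 of exponent divisible by #|Q|, which is in the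
    kernel of f, then moves c into cen x i.+1. *)
Lemma centralizer_control i : exists K, forall n x (Q : finGroupType) (f : ghom G Q),
  Sball n x -> exists (Q' : finGroupType) (f' : ghom G Q'),
  (#|Q'| <= pbound K (n + #|Q|))%N /\ controls_centralizer x i f f'.
Proof.
elim: i => [|i [K IHK]].
  exists 1%N => n x Q f _; exists Q, f; split.
    by rewrite /pbound expn1 -addnA (leq_trans _ (leq_addl _ _)) // leq_addr.
  split=> // g v _ _; exists g, 1; split; rewrite ?mulg1 ?gmulf1 //.
  exact: (cen_top chn).
have [L genL] := cen_generated_exists chn genS i.
have [M boundM] := jump_generator_bound chn genL.
have [b [B bB] deepb] := deep_finite_quotient chn.
have [K' K'P] : poly_bounded (fun N =>
    pbound K (N + pbound B (pbound M N * N + 1) * N))%N.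
  apply: (poly_comp (poly_pbound K)); apply: poly_add poly_id _.
  apply: poly_mul poly_id; apply: (poly_comp (poly_pbound B)).
  by apply: poly_add (poly_const 1); apply: poly_mul (poly_pbound M) poly_id.
exists K' => n x Q f xS; have [m mM mP] := boundM n x xS.
(* If m = 0, then cen x i.+1 = cen x i and any depth will do. *)
pose e := if (m == 0)%N then 1%N else (m * #|Q|)%N.
have Q0 : (0 < #|Q|)%N by apply/card_gt0P; exists 1.
have e0 : (0 < e)%N by rewrite /e; case: eqP => // /eqP; lia.
have [Qe [fe [Qeb deepe]]] := deepb e e0.
have [Q1 [f1 [cQ1 kerf1]]] := ghom_pair fe f.
have [Q' [f' [Q'b [f'f1 f'c]]]] := IHK n x Q1 f1 xS.
exists Q', f'; split.
  apply: leq_trans Q'b (leq_trans _ (K'P _)); apply: pbound_mono.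
  apply: leq_add; first exact: leq_addr.
  rewrite cQ1 leq_mul ?leq_addl //; apply: leq_trans Qeb _.
  apply: leq_trans (bB e) _; apply: pbound_mono.
  rewrite /e; case: eqP => _; first exact: leq_addl.
  apply: leq_trans (leq_addr _ _); rewrite leq_mul ?leq_addl //.
  by apply: leq_trans mM _; apply: pbound_mono; rewrite leq_addr.
split=> [g /f'f1/kerf1[] //|g v f'v Hv].
have [c [u [xc /kerf1[feu fu] eg]]] := f'c g v f'v (chain_le chn Hv).
have [s xs] : exists s : int, coord i [~ x, c] s by apply: (shift_exists chn).
have vE : v * [~ x, g] = (v * [~ x, u]) * [~ x, c] ^ u.
  by rewrite eg /commg /conjg !gnorm.
have vs : coord i (v * [~ x, u]) (- s)%R.
  rewrite -(mulgK ([~ x, c] ^ u) (v * _)) -vE -[(- s)%R]GRing.add0r.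
  apply: (coordM chn); first exact/(coord0 H z).
  by apply: (coordV chn); apply: (coordJ chn).
have [k vk] : exists k : int, coord i (v * [~ x, u]) (Posz e * k)%R.
  apply: deepe => //; last exact: (coord_mem chn) vs.
  have [fev _] := proj1 (kerf1 v) (f'f1 v f'v).
  by rewrite /mkset gmulfM fev mul1g ker_comm.
have [m0|m0] := eqVneq m 0%N.
  exists c, u; split=> //; apply/(shift0 H z).
  have /mP[q eq_s] : jump x i s by exists c.
  by move: xs; rewrite eq_s m0 GRing.mulr0.
have [c0 xc0] : jump x i (Posz m) by apply/mP; exists 1%R; rewrite GRing.mul1r.
have eE : e = (m * #|Q|)%N by rewrite /e (negPf m0).
pose d := c0 ^+z (Posz #|Q| * k)%R.
have xd : coord i [~ x, d] (Posz m * (Posz #|Q| * k))%R by apply: (shiftXz chn).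
exists (c * d), (d^-1 * u); split; last by rewrite mulgA mulgK.
  apply/(shift0 H z); apply: (coord_change chn) (shiftM chn xs xd) _.
  have := coord_sub chn vk vs; rewrite eE PoszM; congr (H _ (_ ^+z _)).
  by lia.
by rewrite gmulfM gmulfV ker_card invg1 mul1g.
Qed.

Lemma separation_at i : exists K, forall n x y, Sball n x -> Sball n y ->
  conj_below x y i -> ~ conj_below x y i.+1 ->
  exists (Q : finGroupType) (f : ghom G Q),
    (#|Q| <= pbound K n)%N /\ forall r, f x <> f (y ^ r).
Proof.
have [Kg shortg] := short_conjugator i.
have [Kc control] := centralizer_control i.
have [L genL] := cen_generated_exists chn genS i.
have [M boundM] := jump_generator_bound chn genL.
have [p [P pP] coordP] := coord_distortion chn S i.
have [b [B bB] deepb] := deep_finite_quotient chn.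
pose E n := (pbound M n + (pbound P (n + (n + (pbound Kg n).*2))).+1)%N.
have pE : poly_bounded E.
  apply: poly_add (poly_pbound M) _.
  apply: (@poly_le _ (fun n => pbound P (n + (n + (pbound Kg n).*2)) + 1)%N).
    by move=> n; rewrite addn1.
  apply: poly_add (poly_const 1); apply: (poly_comp (poly_pbound P)).
  by do 2 apply: poly_add poly_id _; apply/poly_double/poly_pbound.
have [K KP] : poly_bounded (fun n => pbound Kc (n + pbound B (E n)))%N.
  apply: (poly_comp (poly_pbound Kc)); apply: poly_add poly_id _.
  exact: poly_comp (poly_pbound B) pE.
exists K => n x y xS yS conj_i nconj_i.
have [g gS Hg] := shortg n x y xS yS conj_i.
have [t tP gt] := coordP _ _ Hg (ballM (ballV xS) (ballJ yS gS)).
have [m mM mP] := boundM n x xS.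
have nt : ~ jump x i (- t)%R.
  by move=> [c ct]; apply: nconj_i; exists (g * c); apply: conj_below_shift gt ct.
(* - t is outside m Z; this choice keeps it outside m Z + e Z. *)
pose e := if (m == 0)%N then `|t|.+1 else m.
have e0 : (0 < e)%N by rewrite /e; case: eqP => // /eqP; rewrite lt0n.
have eE : (e <= E n)%N.
  rewrite /e /E; case: eqP => _; last by rewrite (leq_trans mM) // leq_addr.
  apply: leq_trans (leq_addl _ _); rewrite ltnS (leq_trans tP) //; exact: pP.
have [Qe [fe [Qeb deepe]]] := deepb e e0.
have [Q [f [Qb [ffe fc]]]] := control n x Qe fe xS.
exists Q, f; split.
  apply: leq_trans Qb (leq_trans _ (KP n)); apply: pbound_mono.
  rewrite leq_add2l (leq_trans Qeb) // (leq_trans (bB e)) //.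
  exact: pbound_mono.
move=> r efr; pose r' := g^-1 * r; pose v := x^-1 * y ^ r.
have fv : f v = 1 by rewrite gmulfM gmulfV efr mulVg.
have vE : v = [~ x, r'] * (x^-1 * y ^ g) ^ r'.
  by rewrite /v /r' /commg /conjg !gnorm.
have [||c [u [xc feu er']]] := fc r' v^-1.
- by rewrite gmulfV fv invg1.
- rewrite vE invgM mulgVK; apply: subgroupV => //; exact: (chain_conj chn).
have [s xs] : exists s : int, coord i [~ x, c] s by apply: (shift_exists chn).
have v1 : coord i ([~ x, u]^-1 * v) (s + t)%R.
  rewrite (_ : _ * _ = [~ x, c] ^ u * (x^-1 * y ^ g) ^ r').
    by apply: (coordM chn); apply: (coordJ chn).
  by rewrite vE er' /commg /conjg !gnorm.
have [k v1k] : exists k : int, coord i ([~ x, u]^-1 * v) (Posz e * k)%R.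
  apply: deepe => //; last exact: (coord_mem chn) v1.
  by rewrite /mkset gmulfM gmulfV ker_comm // invg1 mul1g; apply: ffe.
have /mP[a ea] : jump x i (s + t - Posz e * k)%R.
  by apply: (jump_modulus chn); apply: (coord_sub chn) v1 v1k.
have /mP[a' ea'] : jump x i s by exists c.
apply: nt; apply/mP; move: e0 ea; rewrite ea' /e; case: eqP => [->|_ _ ea].
  move=> _ ea; exists 0%R; have et : t = (Posz `|t|.+1 * k)%R by lia.
  have [k0|k0] := eqVneq k 0%R; first by rewrite et k0 !GRing.mulr0 GRing.oppr0.
  move: k0 (congr1 absz et); rewrite abszM absz_nat -absz_gt0.
  by move: `|k|%N => q q0 eq_t; have := leq_pmulr `|t|.+1 q0; rewrite -eq_t ltnn.
by exists (a' - k - a)%R; lia.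
Qed.

Lemma separation i : exists K, forall n x y, Sball n x -> Sball n y ->
  ~ conj_below x y i ->
  exists (Q : finGroupType) (f : ghom G Q),
    (#|Q| <= pbound K n)%N /\ forall r, f x <> f (y ^ r).
Proof.
elim: i => [|i [K IHK]].
  by exists 0%N => n x y _ _ []; exists 1; apply: (chain_top chn).
have [L sepL] := separation_at i.
exists (maxn K L) => n x y xS yS nconj.
have [conj_i|nconj_i] := pselect (conj_below x y i).
  have [Q [f [Qb fP]]] := sepL n x y xS yS conj_i nconj.
  by exists Q, f; split=> //; apply: leq_trans Qb (pbound_le _ (leq_maxr _ _)).
have [Q [f [Qb fP]]] := IHK n x y xS yS nconj_i.
by exists Q, f; split=> //; apply: leq_trans Qb (pbound_le _ (leq_maxl _ _)).
Qed.

Theorem polynomial_separation : exists K, forall n x y, Sball n x -> Sball n y ->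
  ~ conjugated x y -> exists (Q : finGroupType) (f : ghom G Q),
    (#|Q| <= pbound K n)%N /\ forall r, f x <> f (y ^ r).
Proof.
have [K sepK] := separation h; exists K => n x y xS yS nconj.
apply: sepK => // -[g /(chain_end chn) /mulg1_eq]; rewrite invgK => exy.
by apply: nconj; exists g^-1; rewrite exy conjgK.
Qed.

End Separation.

(** * Word length and conjugacy depth *)

Section Conclusion.
Local Open Scope group_scope.
Local Open Scope classical_set_scope.

(** Only surjective morphisms count for the conjugacy depth. *)
Lemma surjective_corestriction (G : groupType) (Q : finGroupType) (f : ghom G Q) :
  exists (Q' : finGroupType) (f' : {multiplicative G -> Q'}) (e : Q' -> Q),
  [/\ range f' = setT, (forall g, e (f' g) = f g),
      {morph e : x y / x ^ y} & (#|Q'| <= #|Q|)%N].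
Proof.
pose A : {set Q} := finset (fun q => `[< exists g, f g = q >]).
have AP q : reflect (exists g, f g = q) (q \in A).
  by rewrite inE; apply: asboolP.
have gA : group_set A.
  apply/group_setP; split; first by apply/AP; exists 1; apply: gmulf1.
  by move=> _ _ /AP[g <-] /AP[g' <-]; apply/AP; exists (g * g'); apply: gmulfM.
pose B := Group gA; have fB g : f g \in B by apply/AP; exists g.
pose f' g : subg_of B := subg B (f g).
have f'M : {morph f' : x y / x * y}.
  by move=> x y; rewrite /f' gmulfM subgM //; apply: fB.
pose F : {multiplicative G -> subg_of B} :=
  HB.pack f' (isMultiplicative.Build G (subg_of B) f' f'M).
exists (subg_of B), F, sgval; split.
- apply/seteqP; split=> // q _; have [g eg] : exists g, f g = sgval q by apply/AP/(subgP q).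
  by exists g => //; apply: val_inj; rewrite /= /f' subgK.
- by move=> g; rewrite /= /f' subgK.
- by [].
- exact: leq_card _ (@subg_inj _ B).
Qed.

Lemma CD_le (R : realType) (G : groupType) (x y : G) (Q : finGroupType)
    (f : ghom G Q) K : (forall r, f x <> f (y ^ r)) -> (#|Q| <= K)%N ->
  (CD R x y <= (K%:R)%:E)%E.
Proof.
move=> fxy QK; have [Q' [f' [e [f'T ef eJ Q'Q]]]] := surjective_corestriction f.
apply: (@Order.POrderTheory.le_trans _ _ ((#|Q'|%:R : R)%R%:E)); last first.
  by rewrite lee_fin Num.Theory.ler_nat (leq_trans Q'Q).
apply: ereal_inf_lbound; exists #|Q'| => //; exists Q', f'; split=> //.
move=> [q eq_q]; have [r _ er] : range f' q by rewrite f'T.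
apply: (fxy r^-1); rewrite gmulfJ gmulfV -[f y]ef eq_q eJ -er !ef.
by rewrite conjgK.
Qed.

Lemma word_length_ball (R : realType) (G : groupType) (S : seq G) n (x : G) :
  (word_length R S x <= (n%:R)%:E)%E -> ball [set` S] n x.
Proof.
move=> xn; have : (word_length R S x < (n.+1%:R)%:E)%E.
  by apply: Order.POrderTheory.le_lt_trans xn _; rewrite lte_fin Num.Theory.ltr_nat.
move=> /ereal_inf_lt[_ [w [wS wx] <-]]; rewrite lte_fin Num.Theory.ltr_nat ltnS => wn.
by exists w; split=> // s /wS /orP[]; [left|right].
Qed.

Lemma Conj_le (R : realType) (G : groupType) (S : seq G) n (M : \bar R) :
  (0 <= M)%E -> (forall x y : G, ~ conjugated x y -> ball [set` S] n x ->
    ball [set` S] n y -> (CD R x y <= M)%E) -> (Conj R S n <= M)%E.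
Proof.
move=> M0 CDM; rewrite /Conj; set V := [set _ | _ in _].
have ubM : ubound V M.
  move=> _ [[x y] [/= nxy xn yn] <-].
  exact: CDM nxy (word_length_ball xn) (word_length_ball yn).
rewrite /supremum; case: ifPn => // V0.
have [s sV] := ereal_supremums_neq0 V.
by case: xgetP => [t _ [_]|/(_ s) //]; apply.
Qed.

End Conclusion.

Local Open Scope ring_scope.

Theorem theorem1p7 (R : realType) (G : groupType) (fgG : finitely_generated G)
    (nilG : nilpotent_group G) :
  exists2 k : nat, (0 < k)%N &
    forall S : seq G, generating S ->
      growth_le (Conj R S) (fun n : nat => ((n ^ k)%N%:R)%:E).
Proof.
have [H [z [h chn]]] := nilpotent_has_chain fgG nilG.
have [S0 genS0] := fgG.
have [K sepK] := polynomial_separation chn genS0.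
exists K.+1 => // S genS.
have [A SA] : exists A, forall s, [set` S]%classic s -> ball [set` S0]%classic A s.
  elim: S {genS} => [|s S [A SA]]; first by exists 0%N.
  have [B sB] := generating_ball genS0 s.
  exists (maxn A B) => u /=; rewrite inE => /predU1P[->|uS].
    by apply: ball_mono sB; rewrite leq_maxr.
  by apply: ball_mono (SA u uS); rewrite leq_maxl.
exists (A + K).+1 => // n n0.
apply: Conj_le => [|x y nxy xS yS]; first by rewrite -EFinM lee_fin -GRing.natrM Num.Theory.ler0n.
have [Q [f [QK fxy]]] := sepK _ x y (ball_trans SA xS) (ball_trans SA yS) nxy.
rewrite -EFinM -GRing.natrM; apply: CD_le fxy _; apply: leq_trans QK _.
rewrite /pbound; set C := (A + K).+1.
apply: (@leq_trans ((C * n) ^ K)%N); first by apply: leq_expl; rewrite /C; nia.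
by rewrite -[leqLHS]mul1n leq_mul // leq_pexp2l // muln_gt0 n0.
Qed.
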